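(* A commuting contractive pair $(T_1,T_2)$ has a strongly minimal And\^o lift if and only if both factorizations $T_1\cdot T_2$ and $T_2\cdot T_1$ of $T=T_1T_2$ are regular. In this case, there is a unique strongly minimal canonical special And\^o tuple for $(T_1,T_2)$.
   Context: Commuting contractive pair: commuting operators of norm at most $1$ on a Hilbert space $\mathcal H$. $D_A=(I-A^*A)^{1/2}$, $\mathcal D_A=\overline{\operatorname{Ran}}\,D_A$ for a contraction $A$. And\^o lift of $(T_1,T_2)$: $(\Pi,V_1,V_2)$ with $\Pi:\mathcal H\to\mathcal K$ isometric and commuting isometries $V_1,V_2$ on $\mathcal K$ with $V_j^*\Pi=\Pi T_j^*$. Strongly minimal: $\mathcal K=\bigvee_{n\ge0}V_1^nV_2^n\operatorname{Ran}\Pi$. A factorization $T=T'\cdot T''$ of a contraction into contractions is regular if the isometry $Z:\mathcal D_T\to\mathcal D_{T'}\oplus\mathcal D_{T''}$, $D_Th\mapsto D_{T'}T''h\oplus D_{T''}h$, is surjective. Canonical special And\^o tuple for $(T_1,T_2)$: a tuple $(\mathcal F_\dagger,\Lambda_\dagger,P_\dagger,U_\dagger)$ where $\mathcal F_\dagger=\mathcal D_{T_1}\oplus\mathcal D_{T_2}\oplus\mathcal F_{\dagger0}$ for some Hilbert space $\mathcal F_{\dagger0}$ (possibly $\{0\}$); $\Lambda_\dagger:\mathcal D_T\to\mathcal F_\dagger$ is the isometry determined by $D_Th\mapsto D_{T_1}T_2h\oplus D_{T_2}h\oplus0$; $U_\dagger$ is any unitary on $\mathcal F_\dagger$ with $U_\dagger(D_{T_1}T_2h\oplus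 D_{T_2}h\oplus0)=D_{T_1}h\oplus D_{T_2}T_1h\oplus0$ for all $h\in\mathcal H$; and $P_\dagger(d\oplus r\oplus f)=d\oplus0\oplus P_{\dagger0}f$ for some orthogonal projection $P_{\dagger0}$ on $\mathcal F_{\dagger0}$. It is strongly minimal if $\Lambda_\dagger$ maps onto $\mathcal F_\dagger$. *)

(* Defs.v *)
From HB Require Import structures.
From mathcomp Require Import all_boot all_order all_algebra.
From mathcomp Require Import sesquilinear complex.
From mathcomp Require Import boolp classical_sets functions reals.
From mathcomp Require Import interval_inference topology normedtype.

Set Implicit Arguments.
Unset Strict Implicit.
Unset Printing Implicit Defensive.

Import Order.TTheory GRing.Theory Num.Theory.
Import numFieldNormedType.Exports.

Local Open Scope classical_set_scope.
Local Open Scope ring_scope.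

(* The inner product is linear in its first argument. *)
HB.mixin Record NormedModule_isPreHilbert (C : numClosedFieldType) V
    & NormedModule C V := {
  hdot_subdef : {dot V for @Num.conj C};
  hdot_norm_subproof : forall x : V, hdot_subdef x x = `|x| ^+ 2
}.

#[short(type="preHilbertType")]
HB.structure Definition PreHilbert (C : numClosedFieldType) :=
  {V of NormedModule C V & NormedModule_isPreHilbert C V}.

#[short(type="hilbertType")]
HB.structure Definition Hilbert (C : numClosedFieldType) :=
  {V of PreHilbert C V & Complete V}.

Definition hdot (C : numClosedFieldType) (V : preHilbertType C) :
  {dot V for @Num.conj C} := hdot_subdef.
Arguments hdot {C V}.

Notation "''[' u , v ]" := (hdot u v) : ring_scope.

Lemma hdot_norm (C : numClosedFieldType) (V : preHilbertType C) (x : V) :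
  '[x, x] = `|x| ^+ 2.
Proof. exact: hdot_norm_subproof. Qed.

HB.factory Record Lmodule_isPreHilbert (C : numClosedFieldType) V
    & GRing.Lmodule C V := {
  dot : {dot V for @Num.conj C}
}.

HB.builders Context C V & Lmodule_isPreHilbert C V.

Let norm (x : V) : C := sqrtC (dot x x).

Let norm2 x : norm x ^+ 2 = dot x x. Proof. exact: sqrtCK. Qed.

Let norm_ge0 x : 0 <= norm x. Proof. by rewrite sqrtC_ge0 dnorm_ge0. Qed.

Let cauchy_schwarz x y : `|dot x y| <= norm x * norm y.
Proof.
have [->|y0] := eqVneq y 0; first by rewrite linear0r normr0 mulr_ge0.
rewrite -ler_sqr ?nnegrE ?mulr_ge0// exprMn !norm2.
have yy : 0 < dot y y by rewrite dnorm_gt0.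
pose a := dot x y / dot y y; have o : dot (x - a *: y) y = 0.
  by rewrite linearBl /= linearZl_LR divfK ?subrr// gt_eqF.
have -> : dot x x = dot (x - a *: y) (x - a *: y) + `|a| ^+ 2 * dot y y.
  rewrite -dnormZ -hnormDd /= ?subrK//.
  by rewrite linearZr_LR /= o mulr0.
have {1}-> : `|dot x y| ^+ 2 = `|a| ^+ 2 * dot y y * dot y y.
  rewrite -mulrA -expr2 /a normf_div expr_div_n (ger0_norm (ltW yy)) divfK//.
  by rewrite expf_neq0// gt_eqF.
by rewrite mulrDl lerDr mulr_ge0 ?dnorm_ge0.
Qed.

Let ler_normD x y : norm (x + y) <= norm x + norm y.
Proof.
rewrite -ler_sqr ?nnegrE ?addr_ge0// norm2 sqrrD !norm2 dnormD.
rewrite addrAC lerD2r lerD2l.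
have -> : dot x y + (dot x y)^* = 2 * 'Re (dot x y).
  by rewrite ReE mulrC divfK// pnatr_eq0.
rewrite -[leRHS]mulr_natl ler_pM2l ?ltr0n//.
exact: le_trans (leif_Re_Creal (dot x y)) (cauchy_schwarz x y).
Qed.

Let normrZ (l : C) x : norm (l *: x) = `|l| * norm x.
Proof. by rewrite /norm dnormZ rootCMl ?exprn_ge0// sqrCK. Qed.

Let normr0_eq0 x : norm x = 0 -> x = 0.
Proof. by move/eqP; rewrite sqrtC_eq0 dnorm_eq0 => /eqP. Qed.

HB.instance Definition _ :=
  Lmodule_isNormed.Build C V ler_normD normrZ normr0_eq0.

HB.instance Definition _ :=
  NormedModule_isPreHilbert.Build C V (fun x => esym (norm2 x)).

HB.end.

HB.structure Definition BoundedOperator (C : numClosedFieldType)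
    (H K : normedModType C) :=
  {f of @GRing.Linear C H K *:%R f & @isContinuous H K f}.

Notation "''B(' H , K )" := (BoundedOperator.type H K)
  (at level 8, format "''B(' H ,  K )") : type_scope.

Section BoundedOperatorInstances.
Variables (C : numClosedFieldType) (H K L : normedModType C).

HB.instance Definition _ := gen_eqMixin 'B(H, K).
HB.instance Definition _ := gen_choiceMixin 'B(H, K).

Let continuous_zero : continuous (\0 : H -> K).
Proof. by move=> ?; exact: cvg_cst. Qed.

HB.instance Definition _ := isContinuous.Build H K (\0 : H -> K) continuous_zero.

Let continuous_comp_op (A : 'B(K, L)) (B : 'B(H, K)) : continuous (A \o B).
Proof. by move=> x; apply: continuous_comp; exact: cts_fun. Qed.

HB.instance Definition _ (A : 'B(K, L)) (B : 'B(H, K)) :=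
  isContinuous.Build H L (A \o B) (continuous_comp_op (A:=A) (B:=B)).

End BoundedOperatorInstances.

Lemma nonexpansive_cvg (C : numClosedFieldType) (V : normedModType C)
    (W : completeNormedModType C) (F : set_system V) (FF : ProperFilter F)
    (p : V -> W) :
  (forall x y, `|p x - p y| <= `|x - y|) -> cauchy F ->
  exists l : W, p x @[x --> F] --> l.
Proof.
move=> pP /cauchy_ballP cF.
suff /cauchy_cvg/cvg_ex : cauchy (p @ F : set_system W) by [].
apply/cauchy_ballP => e /(cF e)[[A B] [/= FA FB] sAB].
exists (p @` A, p @` B).
  by split; [apply: filterS FA|apply: filterS FB] => x; exists x.
case=> _ _ [/= [x Ax <-] [y By <-]]; have := sAB (x, y) (conj Ax By).
by rewrite -!ball_normE /=; exact: le_lt_trans.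
Qed.

Section ClosedSubspaces.
Variables (C : numClosedFieldType) (H : normedModType C).

Definition is_closed_subspace (S : set H) : Prop :=
  submod_closed (fun x : H => x \in S) /\ closed S.

Record closedSubspace := ClosedSubspace {
  subspace_set :> set H;
  subspaceP : is_closed_subspace subspace_set
}.

Definition closed_span (A : set H) : set H := smallest is_closed_subspace A.

End ClosedSubspaces.

Definition subspace_type (C : numClosedFieldType) (H : normedModType C)
  (S : closedSubspace H) : Type := {x : H | x \in (S : set H)}.

Section SubspaceHilbert.
Variables (C : numClosedFieldType) (H : hilbertType C) (S : closedSubspace H).
Local Notation T := (subspace_type S).

HB.instance Definition _ := SubChoice.on T.
HB.instance Definition _ :=
  GRing.SubChoice_isSubLmodule.Build C H (fun x : H => x \in (S : set H)) T
    (GRing.submod_closed_semi (subspaceP S).1).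

Definition subspace_dot (x y : T) : C := '[val x, val y].

Let subspace_dot_bilinear : bilinear_for ( *%R : GRing.Scale.law C C)
  ((@Num.conj C \; *%R) : GRing.Scale.law C C) subspace_dot.
Proof.
split=> u a x y; rewrite /subspace_dot linearP.
  by rewrite linearDl linearZl_LR.
by [].
Qed.

HB.instance Definition _ :=
  bilinear_isBilinear.Build C T T C *%R (@Num.conj C \; *%R) subspace_dot
    subspace_dot_bilinear.

Let subspace_dot_hermitian x y :
  subspace_dot x y = (-1) ^+ false * (subspace_dot y x)^*.
Proof. exact: hermC. Qed.

HB.instance Definition _ :=
  isHermitianSesquilinear.Build C T false (@Num.conj C) subspace_dot
    subspace_dot_hermitian.

Let subspace_dot_gt0 x : x != 0 -> 0 < subspace_dot x x.
Proof. by move=> x0; rewrite /subspace_dot dnorm_gt0 raddf_eq0 //; exact: val_inj. Qed.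

HB.instance Definition _ := isDotProduct.Build C T subspace_dot subspace_dot_gt0.

HB.instance Definition _ := Lmodule_isPreHilbert.Build C T subspace_dot.

Lemma subspace_norm (x : T) : `|x| = `|val x|.
Proof. by apply/eqP; rewrite -(eqrXn2 (n:=2))// -!hdot_norm. Qed.

Let subspace_complete (F : set_system T) :
  ProperFilter F -> cauchy F -> cvg F.
Proof.
move=> FF cF.
have [|l vl] := nonexpansive_cvg FF (p := val : T -> H) _ cF.
  by move=> x y; rewrite subspace_norm linearB.
have Sl : l \in (S : set H).
  rewrite inE; apply: (closed_cvg (subspace_set S) (subspaceP S).2 _ l vl).
  by apply: nearW => x; have := valP x; rewrite inE.
apply/cvg_ex; exists (Sub l Sl : T); apply/fcvgrPdist_lt => e e0.
have /cvgrPdist_lt/(_ e e0) := vl; apply: filterS => x.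
by rewrite subspace_norm linearB.
Qed.

HB.instance Definition _ := Uniform_isComplete.Build T subspace_complete.

End SubspaceHilbert.

(* [H * K] carries the sup norm in the library, hence the alias. *)
Definition hsum (C : numClosedFieldType) (H K : lmodType C) : Type :=
  (H * K)%type.

Section DirectSum.
Variables (C : numClosedFieldType) (H K : hilbertType C).
Local Notation T := (hsum H K).

HB.instance Definition _ := GRing.Lmodule.copy T (H * K)%type.

Definition hsum_dot (x y : T) : C := '[x.1, y.1] + '[x.2, y.2].

Let hsum_dot_bilinear : bilinear_for ( *%R : GRing.Scale.law C C)
  ((@Num.conj C \; *%R) : GRing.Scale.law C C) hsum_dot.
Proof.
split=> u a x y; rewrite /hsum_dot /=.
  by rewrite !linearDl !linearZl_LR mulrDr addrACA.
by rewrite !linearDr !linearZr_LR mulrDr addrACA.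
Qed.

HB.instance Definition _ :=
  bilinear_isBilinear.Build C T T C *%R (@Num.conj C \; *%R) hsum_dot
    hsum_dot_bilinear.

Let hsum_dot_hermitian x y :
  hsum_dot x y = (-1) ^+ false * (hsum_dot y x)^*.
Proof. by rewrite /hsum_dot rmorphD mulrDr -!hermC. Qed.

HB.instance Definition _ :=
  isHermitianSesquilinear.Build C T false (@Num.conj C) hsum_dot
    hsum_dot_hermitian.

Let hsum_dot_gt0 x : x != 0 -> 0 < hsum_dot x x.
Proof.
move=> x0; rewrite lt_def addr_ge0 ?dnorm_ge0// andbT.
rewrite paddr_eq0 ?dnorm_ge0// !dnorm_eq0; apply: contra x0.
by case: x => x y /= /andP[/eqP-> /eqP->].
Qed.

HB.instance Definition _ := isDotProduct.Build C T hsum_dot hsum_dot_gt0.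

HB.instance Definition _ := Lmodule_isPreHilbert.Build C T hsum_dot.

Lemma hsum_norm (x : T) : `|x| ^+ 2 = `|x.1| ^+ 2 + `|x.2| ^+ 2.
Proof. by rewrite -!hdot_norm. Qed.

Let hsum_norm1 (x : T) : `|x.1| <= `|x|.
Proof.
by rewrite -ler_sqr ?nnegrE// hsum_norm lerDl exprn_ge0.
Qed.

Let hsum_norm2 (x : T) : `|x.2| <= `|x|.
Proof.
by rewrite -ler_sqr ?nnegrE// hsum_norm lerDr exprn_ge0.
Qed.

Let hsum_normD (x : T) : `|x| <= `|x.1| + `|x.2|.
Proof.
rewrite -ler_sqr ?nnegrE ?addr_ge0// hsum_norm sqrrD lerD2r lerDl.
by rewrite mulrn_wge0// mulr_ge0.
Qed.

Let hsum_complete (F : set_system T) :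
  ProperFilter F -> cauchy F -> cvg F.
Proof.
move=> FF cF.
have [l1 l1F] := nonexpansive_cvg FF (p := fst : T -> H)
  (fun x y => hsum_norm1 (x - y)) cF.
have [l2 l2F] := nonexpansive_cvg FF (p := snd : T -> K)
  (fun x y => hsum_norm2 (x - y)) cF.
apply/cvg_ex; exists ((l1, l2) : T); apply/fcvgrPdist_lt => e e0.
have e20 : 0 < e / 2 by rewrite divr_gt0.
have /cvgrPdist_lt/(_ _ e20) F1 := l1F; have /cvgrPdist_lt/(_ _ e20) F2 := l2F.
apply: filterS2 F1 F2 => x x1 x2; rewrite (splitr e).
apply: le_lt_trans (hsum_normD ((l1, l2) - x)) _; exact: ltrD.
Qed.

HB.instance Definition _ := Uniform_isComplete.Build T hsum_complete.

End DirectSum.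

Section ClosedRange.
Variables (C : numClosedFieldType) (H K : normedModType C) (A : 'B(H, K)).

Lemma closed_range_subproof : is_closed_subspace (closure (range A)).
Proof.
split; last exact: closed_closure.
split.
  by rewrite inE; apply: subset_closure; exists 0 => //; rewrite linear0.
move=> a x y; rewrite !inE => cx cy B Bxy.
have : a *: z.1 + z.2 @[z --> (x, y)] --> a *: x + y.
  by apply: cvgD; [apply: cvgZ; [exact: cvg_cst|exact: cvg_fst]|exact: cvg_snd].
case/(_ B Bxy) => -[P Q] [/= /cx[_ [[u _ <-] Pu]] /cy[_ [[v _ <-] Qv]]] PQB.
exists (A (a *: u + v)); split; first by exists (a *: u + v).
by rewrite linearP; exact: (PQB (A u, A v)).
Qed.

Definition closed_range : closedSubspace K :=
  ClosedSubspace closed_range_subproof.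

Lemma closed_rangeP (h : H) : A h \in (closed_range : set K).
Proof. by rewrite inE; apply: subset_closure; exists h. Qed.

End ClosedRange.

Section Operators.
Variables (C : numClosedFieldType) (H K : hilbertType C).

Definition is_adjoint (A : 'B(H, K)) (B : 'B(K, H)) : Prop :=
  forall x y, '[A x, y] = '[x, B y].

(* The default [\0] is never reached, by the Riesz representation theorem,
   when [C] is the field of complex numbers. *)
Definition adjoint (A : 'B(H, K)) : 'B(K, H) :=
  xget (\0 : 'B(K, H)) [set B | is_adjoint A B].

Definition contractive (A : 'B(H, K)) : Prop := forall x, `|A x| <= `|x|.

Definition isometric (A : 'B(H, K)) : Prop := forall x, `|A x| = `|x|.

Definition onto (A : 'B(H, K)) : Prop := range A = setT.

Definition unitary (A : 'B(H, K)) : Prop := isometric A /\ onto A.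

End Operators.

Section Defect.
Variables (C : numClosedFieldType) (H : hilbertType C).

Definition orthogonal_projection (P : 'B(H, H)) : Prop :=
  P \o P =1 P /\ is_adjoint P P.

(* Over the complex numbers positivity of the form implies self-adjointness. *)
Definition positive_operator (A : 'B(H, H)) : Prop := forall x, 0 <= '[A x, x].

(* The positive square root of [A]; the default [\0] is only used when there is
   none. *)
Definition operator_sqrt (A : H -> H) : 'B(H, H) :=
  xget (\0 : 'B(H, H)) [set B | positive_operator B /\ B \o B =1 A].

Definition defect (A : 'B(H, H)) : 'B(H, H) :=
  operator_sqrt (fun x => x - adjoint A (A x)).

Definition defect_space (A : 'B(H, H)) : hilbertType C :=
  subspace_type (closed_range (defect A)).

Definition to_defect_space (A : 'B(H, H)) (h : H) : defect_space A :=
  exist _ (defect A h) (closed_rangeP (defect A) h).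

Definition regular_factorization (T T' T'' : 'B(H, H)) : Prop :=
  T =1 T' \o T'' /\
  exists Z : 'B(defect_space T, hsum (defect_space T') (defect_space T'')),
    [/\ isometric Z,
        forall h, Z (to_defect_space T h) =
                  (to_defect_space T' (T'' h), to_defect_space T'' h)
      & onto Z].

End Defect.

Section AndoLift.
Variables (C : numClosedFieldType) (H : hilbertType C) (T1 T2 : 'B(H, H)).

Record is_ando_lift (K : hilbertType C) (Pi : 'B(H, K)) (V1 V2 : 'B(K, K)) :
    Prop := {
  ando_lift_Pi : isometric Pi;
  ando_lift_V1 : isometric V1;
  ando_lift_V2 : isometric V2;
  ando_lift_comm : V1 \o V2 =1 V2 \o V1;
  ando_lift_T1 : adjoint V1 \o Pi =1 Pi \o adjoint T1;
  ando_lift_T2 : adjoint V2 \o Pi =1 Pi \o adjoint T2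
}.

Definition strongly_minimal_lift (K : hilbertType C) (Pi : 'B(H, K))
    (V1 V2 : 'B(K, K)) : Prop :=
  closed_span (\bigcup_n range (fun h => iter n V1 (iter n V2 (Pi h)))) = setT.

Definition has_strongly_minimal_ando_lift : Prop :=
  exists (K : hilbertType C) (Pi : 'B(H, K)) (V1 V2 : 'B(K, K)),
    is_ando_lift Pi V1 V2 /\ strongly_minimal_lift Pi V1 V2.

End AndoLift.

Section AndoTuple.
Variables (C : numClosedFieldType) (H : hilbertType C) (T1 T2 : 'B(H, H)).

Definition ando_space (F0 : hilbertType C) : hilbertType C :=
  hsum (defect_space T1) (hsum (defect_space T2) F0).

Record ando_tuple := AndoTuple {
  ando_F0 : hilbertType C;
  ando_Lambda : 'B(defect_space (T1 \o T2), ando_space ando_F0);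
  ando_P : 'B(ando_space ando_F0, ando_space ando_F0);
  ando_U : 'B(ando_space ando_F0, ando_space ando_F0)
}.

Record is_canonical_special (t : ando_tuple) : Prop := {
  ando_Lambda_isometric : isometric (ando_Lambda t);
  ando_LambdaE : forall h, ando_Lambda t (to_defect_space (T1 \o T2) h) =
    (to_defect_space T1 (T2 h), (to_defect_space T2 h, 0));
  ando_U_unitary : unitary (ando_U t);
  ando_UE : forall h,
    ando_U t (to_defect_space T1 (T2 h), (to_defect_space T2 h, 0)) =
    (to_defect_space T1 h, (to_defect_space T2 (T1 h), 0));
  ando_PE : exists2 P0 : 'B(ando_F0 t, ando_F0 t), orthogonal_projection P0 &
    forall d r f, ando_P t (d, (r, f)) = (d, (0, P0 f))
}.

Definition strongly_minimal_tuple (t : ando_tuple) : Prop :=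
  onto (ando_Lambda t).

(* Equality of tuples, up to the choice of a copy of the abstract Hilbert space
   [ando_F0]: the spaces [defect_space T1] and [defect_space T2] are fixed. *)
Definition ando_tuple_eq (t t' : ando_tuple) : Prop :=
  exists2 tau : 'B(ando_F0 t, ando_F0 t'), unitary tau &
    let Tau (x : ando_space (ando_F0 t)) : ando_space (ando_F0 t') :=
      (x.1, (x.2.1, tau x.2.2)) in
    [/\ Tau \o ando_Lambda t =1 ando_Lambda t',
        Tau \o ando_P t =1 ando_P t' \o Tau
      & Tau \o ando_U t =1 ando_U t' \o Tau].

End AndoTuple.

(* Main.v *)
(** A factorization [T = T' T''] is regular exactly when the vectors
    [(D_T' T'' h, D_T'' h)] are total in [D_T' (+) D_T''].

    Given a lift, [D_T1 g |-> V1 Pi g - Pi T1 g] and [D_T2 h |-> V2 Pi h - Pi T2 h]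
    extend to isometries [W1] and [W2], and [(d, r) |-> W1 d + V1 W2 r] is an
    isometry sending [(D_T1 T2 h, D_T2 h)] to [V Pi h - Pi T h], [V := V1 V2].  A
    vector [w] of its range that is orthogonal to all [V Pi h - Pi T h] is
    orthogonal to every [V^n Pi h], because [V^* w] is in the closure of
    [Ran Pi]; strong minimality then gives [w = 0].

    Conversely, if both factorizations are regular, there is a unitary [W] on
    [F := D_T1 (+) D_T2] with [W (D_T1 T2 h, D_T2 h) = (D_T1 h, D_T2 T1 h)].  On
    [K := H (+) ell2 F], [V1] applies [T1] to [h], delays the [D_T1]-components of
    the sequence by one step, inserting [D_T1 h], and then applies [W] to each
    term; [V2] applies [W^-1] to each term and then delays the [D_T2]-components,
    inserting [D_T2 h].  Both [V1 V2] and [V2 V1] map [(h, f)] to [T h] followed by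
    [f] delayed by one step with first term [(D_T1 h, D_T2 T1 h)]; totality of
    these first terms is strong minimality.

    In a strongly minimal tuple the extra summand [F_0] is zero, so that everything
    is determined on the total set of vectors [(D_T1 T2 h, D_T2 h, 0)]. *)
Require Import Defs.
From HB Require Import structures.
From mathcomp Require Import all_boot all_order all_algebra.
From mathcomp Require Import sesquilinear complex.
From mathcomp Require Import boolp classical_sets functions reals.
From mathcomp Require Import interval_inference topology normedtype sequences.
From mathcomp Require Import ring lra.

Set Implicit Arguments.
Unset Strict Implicit.
Unset Printing Implicit Defensive.

Import Order.TTheory GRing.Theory Num.Theory.
Import numFieldNormedType.Exports.

Local Open Scope classical_set_scope.
Local Open Scope ring_scope.

(** * Inner products, bounded operators and real-valued norms *)

Section InnerProduct.
Variables (C : numClosedFieldType) (V : preHilbertType C).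
Implicit Types (x y z : V) (a : C).

Lemma hdotDl x y z : '[x + y, z] = '[x, z] + '[y, z].
Proof. exact: linearDl. Qed.

Lemma hdotBl x y z : '[x - y, z] = '[x, z] - '[y, z].
Proof. exact: linearBl. Qed.

Lemma hdotZl a x z : '[a *: x, z] = a * '[x, z].
Proof. exact: linearZl_LR. Qed.

Lemma hdotDr x y z : '[x, y + z] = '[x, y] + '[x, z].
Proof. exact: linearDr. Qed.

Lemma hdotBr x y z : '[x, y - z] = '[x, y] - '[x, z].
Proof. exact: linearBr. Qed.

Lemma hdotZr a x z : '[x, a *: z] = a^* * '[x, z].
Proof. exact: linearZr_LR. Qed.

Lemma hdot0l x : '[0, x] = 0. Proof. exact: linear0l. Qed.

Lemma hdot0r x : '[x, 0] = 0. Proof. exact: linear0r. Qed.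

Lemma hdotC x y : '[x, y] = '[y, x]^*.
Proof. by rewrite hermC expr0 mul1r. Qed.

Lemma hdot_eq0C x y : '[x, y] = 0 -> '[y, x] = 0.
Proof. by rewrite hdotC => /eqP; rewrite conjC_eq0 => /eqP. Qed.

Lemma hdotxx_eq0 x : '[x, x] = 0 -> x = 0.
Proof. by move=> /eqP; rewrite hdot_norm expf_eq0 /= normr_eq0 => /eqP. Qed.

Lemma hdot_inj x y : (forall z, '[z, x] = '[z, y]) -> x = y.
Proof.
move=> xy; apply/eqP; rewrite -subr_eq0; apply/eqP/hdotxx_eq0.
by rewrite hdotBr xy subrr.
Qed.

Lemma norm2D x y : `|x + y| ^+ 2 = `|x| ^+ 2 + `|y| ^+ 2 + ('[x, y] + '[y, x]).
Proof. by rewrite -!hdot_norm hdotDl !hdotDr; ring. Qed.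

Lemma norm2B x y : `|x - y| ^+ 2 = `|x| ^+ 2 + `|y| ^+ 2 - ('[x, y] + '[y, x]).
Proof. by rewrite -!hdot_norm hdotBl !hdotBr; ring. Qed.

(** The vector [|y|^2 x - <x, y> y] has squared norm [|y|^2 (|x|^2 |y|^2 - |<x, y>|^2)]. Scaling by
    [|y|^2] avoids division. *)
Lemma norm_hdot_le x y : `|'[x, y]| <= `|x| * `|y|.
Proof.
have [->|y0] := eqVneq y 0; first by rewrite hdot0r !normr0 mulr0.
have yy : 0 < `|y| ^+ 2 by rewrite exprn_gt0 // normr_gt0.
rewrite -ler_sqr ?nnegrE ?mulr_ge0// exprMn -subr_ge0.
rewrite -(pmulr_rge0 _ yy).
have -> : `|y| ^+ 2 * (`|x| ^+ 2 * `|y| ^+ 2 - `|'[x, y]| ^+ 2) =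
  `| `|y| ^+ 2 *: x - '[x, y] *: y | ^+ 2.
  rewrite norm2B !normrZ !hdotZl !hdotZr !exprMn.
  have -> : (`|y| ^+ 2)^* = `|y| ^+ 2 by rewrite geC0_conj// exprn_ge0.
  by rewrite !normr_id (hdotC y x) normCK; ring.
by rewrite exprn_ge0.
Qed.

End InnerProduct.

Section BoundedOperators.
Variables (C : numClosedFieldType) (H K : normedModType C).

Lemma linear_Lipschitz_continuous (f : {linear H -> K}) (M : C) :
  0 <= M -> (forall x, `|f x| <= M * `|x|) -> continuous f.
Proof.
move=> M0 fM x; apply/cvgrPdist_lt => e e0.
(* [M + 1] replaces [M], which may be 0, as a divisor. *)
have M1 : 0 < M + 1 by rewrite ltr_wpDl.
near=> y; rewrite -linearB; apply: (le_lt_trans (fM _)).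
apply: (@le_lt_trans _ _ ((M + 1) * `|x - y|)).
  by rewrite ler_wpM2r // lerDl.
rewrite mulrC -ltr_pdivlMr //; near: y.
by apply: (@cvgr_dist_lt _ _ _ _ _ idfun x) => //; rewrite divr_gt0.
Unshelve. all: by end_near. Qed.

Lemma bounded_operatorP (f : H -> K) (M : C) : 0 <= M ->
  linear f -> (forall x, `|f x| <= M * `|x|) -> exists A : 'B(H, K), A =1 f.
Proof.
move=> M0 lf fM.
pose lfm := GRing.isLinear.Build C H K *:%R f lf.
pose f1 : {linear H -> K} := HB.pack f lfm.
pose cfm := isContinuous.Build H K f (@linear_Lipschitz_continuous f1 M M0 fM).
pose g : 'B(H, K) := HB.pack f lfm cfm.
by exists g.
Qed.

Lemma bounded_operator_contr (f : H -> K) :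
  linear f -> (forall x, `|f x| <= `|x|) -> exists A : 'B(H, K), A =1 f.
Proof.
by move=> lf fM; apply: (@bounded_operatorP f 1) => // x; rewrite mul1r.
Qed.

End BoundedOperators.

Section RealNorm.
Variable R : realType.
Local Notation C := R[i].
Implicit Types (V : normedModType C).

(** Norms take values in [R[i]]; a copy in [R] gives access to suprema, infima and real
    arithmetic. *)
Definition rnorm V (x : V) : R := complex.Re `|x|.

Lemma rnormE V (x : V) : `|x| = (rnorm x)%:C%C.
Proof. by rewrite /rnorm RRe_real // normr_real. Qed.

Lemma rnorm_ge0 V (x : V) : 0 <= rnorm x.
Proof. by rewrite -ler0c -rnormE. Qed.

Lemma rnorm0_eq0 V (x : V) : rnorm x = 0 -> x = 0.
Proof. by move=> x0; apply/eqP; rewrite -normr_eq0 rnormE x0 rmorph0 eqxx. Qed.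

Lemma rnorm0 V : rnorm (0 : V) = 0.
Proof. by rewrite /rnorm normr0. Qed.

Lemma rnormD V (x y : V) : rnorm (x + y) <= rnorm x + rnorm y.
Proof. by rewrite -lecR rmorphD /= -!rnormE ler_normD. Qed.

Lemma rnormB V (x y : V) : rnorm (x - y) = rnorm (y - x).
Proof. by rewrite /rnorm distrC. Qed.

Lemma rnormZ V (a : C) (x : V) : rnorm (a *: x) = complex.Re `|a| * rnorm x.
Proof.
apply: complexI; rewrite rmorphM /= -rnormE normrZ -rnormE.
by congr (_ * _).
Qed.

Lemma hdot_rnorm (V : preHilbertType C) (x : V) : '[x, x] = (rnorm x ^+ 2)%:C%C.
Proof. by rewrite hdot_norm rnormE rmorphXn. Qed.

Lemma rnorm2D (V : preHilbertType C) (x y : V) :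
  rnorm (x + y) ^+ 2 = rnorm x ^+ 2 + rnorm y ^+ 2 + 2 * complex.Re '[x, y].
Proof.
apply: complexI; rewrite -hdot_rnorm hdotDl !hdotDr !hdot_rnorm (hdotC y x).
case: '[x, y] => a b; apply/eqP; rewrite eq_complex /=.
by apply/andP; split; apply/eqP; ring.
Qed.

Lemma Re_hdotC (V : preHilbertType C) (x y : V) :
  complex.Re '[x, y] = complex.Re '[y, x].
Proof. by rewrite hdotC; case: '[y, x]. Qed.

Lemma rnorm2B (V : preHilbertType C) (x y : V) :
  rnorm (x - y) ^+ 2 = rnorm x ^+ 2 + rnorm y ^+ 2 - 2 * complex.Re '[x, y].
Proof.
apply: complexI; rewrite -hdot_rnorm hdotBl !hdotBr !hdot_rnorm (hdotC y x).
case: '[x, y] => a b; apply/eqP; rewrite eq_complex /=.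
by apply/andP; split; apply/eqP; ring.
Qed.

Lemma parallelogram (V : preHilbertType C) (x y : V) :
  rnorm (x + y) ^+ 2 + rnorm (x - y) ^+ 2 = 2 * rnorm x ^+ 2 + 2 * rnorm y ^+ 2.
Proof. by rewrite rnorm2D rnorm2B; ring. Qed.

Lemma Re_hdot_le (V : preHilbertType C) (x y : V) :
  `|complex.Re '[x, y]| <= rnorm x * rnorm y.
Proof.
rewrite -lecR rmorphM /= -!rnormE.
exact: le_trans (normc_ge_Re _) (norm_hdot_le x y).
Qed.

End RealNorm.

(** * Riesz representation *)

Section Riesz.
Variable R : realType.
Local Notation C := R[i].

Lemma ltr0c_Re (e : C) : 0 < e -> exists2 r : R, 0 < r & e = r%:C%C.
Proof.
by case: e => a b; rewrite ltcE /= => /andP[/eqP -> a0]; exists a.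
Qed.

Lemma rnorm_cauchy_cvg (V : completeNormedModType C) (F : set_system V) :
  ProperFilter F ->
  (forall e : R, 0 < e -> exists2 A, F A &
     forall x y, A x -> A y -> rnorm (x - y) < e) ->
  exists l, forall e : R, 0 < e -> F [set x | rnorm (l - x) < e].
Proof.
move=> FF cF; suff /cvg_ex[l Fl] : cvg F.
  exists l => e e0; have eC : 0 < e%:C%C by rewrite ltcR.
  move/fcvgrPdist_lt : Fl => /(_ _ eC); apply: filterS => x.
  by rewrite rnormE ltcR.
apply: cauchy_cvg; apply/cauchy_ballP => e /ltr0c_Re[r r0 ->].
have [A FA Ar] := cF _ r0; exists (A, A) => //= -[x y] [/= Ax Ay].
by rewrite -ball_normE /= rnormE ltcR; exact: Ar.
Qed.

Lemma rnorm_seq_cvg (V : completeNormedModType C) (x : nat -> V) :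
  (forall e : R, 0 < e -> exists N, forall m n, (N <= m)%N -> (N <= n)%N ->
     rnorm (x m - x n) < e) ->
  exists l, forall e : R, 0 < e ->
    exists N, forall n, (N <= n)%N -> rnorm (l - x n) < e.
Proof.
move=> cx; have PF : ProperFilter (x @ \oo) by apply: fmap_proper_filter.
have [|l lx] := rnorm_cauchy_cvg PF.
  move=> e /cx[N xN]; exists (x @` [set n | (N <= n)%N]).
    by exists N => // n /= Nn; exists n.
  by move=> _ _ [m Nm <-] [n Nn <-]; exact: xN.
by exists l => e /lx[N _ lN]; exists N => n Nn; apply: lN.
Qed.

Lemma sqr_Re_norm (a : C) :
  complex.Re `|a| ^+ 2 = complex.Re a ^+ 2 + complex.Im a ^+ 2.
Proof.
by apply: complexI; rewrite add_Re2_Im2 rmorphXn; congr (_ ^+ 2); rewrite RRe_real ?normr_real.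
Qed.

Lemma Re_normE (a : C) : `|a| = (complex.Re `|a|)%:C%C.
Proof. by rewrite RRe_real // normr_real. Qed.

Lemma Re_normD (a b : C) :
  complex.Re `|a + b| <= complex.Re `|a| + complex.Re `|b|.
Proof. by rewrite -lecR rmorphD /= -!Re_normE ler_normD. Qed.

Lemma Re_norm_eq0 (a : C) : complex.Re `|a| = 0 -> a = 0.
Proof. by move=> a0; apply/eqP; rewrite -normr_eq0 Re_normE a0 rmorph0. Qed.

Lemma Re_norm_hdot_le (V : preHilbertType C) (x y : V) :
  complex.Re `|'[x, y]| <= rnorm x * rnorm y.
Proof. by rewrite -lecR rmorphM /= -!rnormE -Re_normE norm_hdot_le. Qed.

Lemma Re_norm_ge0 (a : C) : 0 <= complex.Re `|a|.
Proof. by rewrite -ler0c RRe_real ?normr_real. Qed.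

Section Functional.
Variables (H : hilbertType C) (f : H -> C) (c : R).
Hypothesis fP : forall a x y, f (a *: x + y) = a * f x + f y.
Hypothesis fc : forall x, complex.Re `|f x| <= c * rnorm x.

(** If [f = <., u>] then [J x = |x - u|^2 - |u|^2], so the representing vector is sought as the
    minimiser of [J]. *)
Let J x := rnorm x ^+ 2 - 2 * complex.Re (f x).

Let fD x y : f (x + y) = f x + f y.
Proof. by rewrite -[x in LHS]scale1r fP mul1r. Qed.

Let f0 : f 0 = 0.
Proof. by apply: (addrI (f 0)); rewrite -fD !addr0. Qed.

Let fZ a x : f (a *: x) = a * f x.
Proof. by rewrite -[X in f X]addr0 fP f0 addr0. Qed.

Let J_lb x : - c ^+ 2 <= J x.
Proof.
have f1 : complex.Re (f x) <= c * rnorm x.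
  apply: le_trans (fc x); apply: le_trans (ler_norm _) _.
  by rewrite -lecR RRe_real ?normr_real // normc_ge_Re.
have := sqr_ge0 (rnorm x - c); rewrite /J; nra.
Qed.

Let JP x b v : J (x + b *: v) = J x + complex.Re `|b| ^+ 2 * rnorm v ^+ 2 +
  2 * complex.Re (b * ('[v, x] - f v)).
Proof.
rewrite /J rnorm2D rnormZ Re_hdotC hdotZl fD fZ mulrBr raddfD raddfB /=; ring.
Qed.

Let m := inf (range J).

Let J_inf : has_inf (range J).
Proof.
split; first by exists (J 0), 0.
by exists (- c ^+ 2) => _ [x _ <-]; exact: J_lb.
Qed.

Let m_le x : m <= J x.
Proof. by apply: ge_inf; [exact: J_inf.2|exists x]. Qed.

(* Compare [J x] with [J (x + b *: v)] for the best scalar [b]. *)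
Let near_min x e v : J x < m + e ->
  complex.Re `|'[v, x] - f v| ^+ 2 <= e * rnorm v ^+ 2.
Proof.
move=> Jx.
have [->|v0] := eqVneq v 0.
  by rewrite hdot0l f0 subrr normr0 rnorm0 /= expr0n /= mulr0.
have n0 : 0 < rnorm v ^+ 2.
  by rewrite exprn_gt0 // lt_def rnorm_ge0 andbT; apply: contra_neq v0 => /rnorm0_eq0.
have := m_le (x + ((- complex.Re ('[v, x] - f v) / rnorm v ^+ 2) +i*
  (complex.Im ('[v, x] - f v) / rnorm v ^+ 2))%C *: v).
rewrite JP !sqr_Re_norm.
case: ('[v, x] - f v) => p q /=; set n := rnorm v ^+ 2 in n0 *.
have -> : ((- p / n) ^+ 2 + (q / n) ^+ 2) * n = (p ^+ 2 + q ^+ 2) / n.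
  by field; rewrite gt_eqF.
have -> : - p / n * p - q / n * q = - ((p ^+ 2 + q ^+ 2) / n).
  by field; rewrite gt_eqF.
move=> h; rewrite -ler_pdivrMr //; lra.
Qed.

(** The sublevel sets of [J] above its infimum generate a Cauchy filter. At its limit [u],
    [near_min] forces [<v, u> = f v] for every [v]. *)
Lemma riesz : exists u, forall x, f x = '[x, u].
Proof.
pose F := filter_from [set e : R | 0 < e] (fun e => [set x | J x < m + e]).
have FF : ProperFilter F.
  apply: filter_from_proper; last first.
    move=> e e0; have [_ [x _ <-] xe] := inf_adherent e0 J_inf; by exists x.
  apply: filter_from_filter; first by exists 1 => /=.
  move=> i j i0 j0; exists (Num.min i j); first by rewrite /= lt_min i0.
  move=> x /=; rewrite -ltrBlDl lt_min !ltrBlDl => /andP[]; by split.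
have [e e0|u Fu] := @rnorm_cauchy_cvg H F FF.
  (* By the parallelogram law, [|x - y|^2 / 2 = J x + J y - 2 J ((x + y) / 2)]. If [J x] and [J y]
     are below [m + d], this is less than [2 d]; the chosen [d] gives [|x - y|^2 < e^2 / 2]. *)
  exists [set x | J x < m + (e / 2) ^+ 2 / 2].
    by exists ((e / 2) ^+ 2 / 2) => //=; rewrite divr_gt0 // exprn_gt0 // divr_gt0.
  move=> x y Jx Jy; rewrite -ltr_sqr ?nnegrE ?rnorm_ge0 ?(ltW e0) //.
  have := m_le (x + (2^-1 : C) *: (y - x)).
  move: Jx Jy; rewrite /J /=.
  have -> : x + (2^-1 : C) *: (y - x) = (2^-1 : C) *: (x + y).
    rewrite scalerBr scalerDr addrCA [LHS]addrC; congr (_ + _).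
    rewrite -[X in X - _]scale1r -scalerBl; congr (_ *: _).
    by rewrite [X in X - _](splitr 1) div1r addrK.
  rewrite rnormZ fZ fD.
  have -> : complex.Re `|2^-1 : C| = 2^-1.
    by rewrite ger0_norm ?invr_ge0// -[2]/(2%:R) -(rmorph_nat (real_complex R)) -fmorphV.
  have -> : complex.Re (2^-1 * (f x + f y)) =
    2^-1 * (complex.Re (f x) + complex.Re (f y)).
    rewrite -[2]/(2%:R) -(rmorph_nat (real_complex R)) -fmorphV.
    by case: (f x) (f y) => a b [a' b'] /=; rewrite mul0r subr0.
  have := parallelogram x y; nra.
exists u => v; apply/esym/eqP; rewrite -subr_eq0; apply/eqP/Re_norm_eq0.
apply/eqP; rewrite eq_le Re_norm_ge0 andbT; apply/ler_addgt0Pr => /= e e0; rewrite add0r.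
have v1 : 0 < rnorm v + 1 by rewrite ltr_wpDl ?rnorm_ge0.
have [d d0 h3] : exists2 d : R, 0 < d & d * (rnorm v + 1) = e / 2.
  exists (e / 2 / (rnorm v + 1)); first by rewrite !divr_gt0.
  by rewrite divfK // gt_eqF.
have Fd : F [set x | J x < m + d ^+ 2] by exists (d ^+ 2) => //=; rewrite exprn_gt0.
have [x [/= Jx ux]] := filter_ex (filterI Fd (Fu _ d0)).
have -> : '[v, u] - f v = '[v, u - x] + ('[v, x] - f v) by rewrite hdotBr; ring.
apply: le_trans (Re_normD _ _) _.
have h1 : complex.Re `|'[v, u - x]| <= rnorm v * d.
  by apply: le_trans (Re_norm_hdot_le _ _) _; rewrite ler_wpM2l ?rnorm_ge0 // ltW.
have h2 : complex.Re `|'[v, x] - f v| <= d * rnorm v.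
  rewrite -ler_sqr ?nnegrE ?Re_norm_ge0 ?mulr_ge0 ?rnorm_ge0 ?(ltW d0) // exprMn.
  exact: near_min.
lra.
Qed.

End Functional.
End Riesz.

(** * Adjoints and orthogonal complements *)

Section Limits.
Variable R : realType.
Local Notation C := R[i].

Lemma cvg_rnorm (V : normedModType C) (u : nat -> V) (l : V) :
  u @ \oo --> l <->
  forall e : R, 0 < e -> exists N, forall n, (N <= n)%N -> rnorm (l - u n) < e.
Proof.
split=> [ul e e0|ul].
  have eC : 0 < e%:C%C by rewrite ltcR.
  have /cvgrPdist_lt /(_ _ eC) [N _ uN] := ul.
  by exists N => n Nn; rewrite -ltcR -rnormE; exact: uN.
apply/cvgrPdist_lt => e /ltr0c_Re[r r0 ->]; have [N uN] := ul _ r0.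
by exists N => // n Nn; rewrite rnormE ltcR; exact: uN.
Qed.

Lemma rnorm_le_cvg (V : normedModType C) (u : nat -> V) (l : V) (M : R) :
  u @ \oo --> l -> (forall n, rnorm (u n) <= M) -> rnorm l <= M.
Proof.
move=> /cvg_rnorm ul uM; apply/ler_addgt0Pr => e /ul[N /(_ N (leqnn N)) lN].
have := rnormD (l - u N) (u N); rewrite subrK; have := uM N; lra.
Qed.

Lemma hdot_eq_cvg (V : preHilbertType C) (u v : nat -> V) (l k x y : V) :
  u @ \oo --> l -> v @ \oo --> k ->
  (forall n, '[u n, y] = '[x, v n]) -> '[l, y] = '[x, k].
Proof.
move=> /cvg_rnorm ul /cvg_rnorm vk uv; apply/eqP; rewrite -subr_eq0; apply/eqP.
apply: Re_norm_eq0; apply/eqP; rewrite eq_le Re_norm_ge0 andbT.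
apply/ler_addgt0Pr => /= e e0; rewrite add0r.
have xy0 : 0 < rnorm x + rnorm y + 1 by rewrite ltr_wpDl ?addr_ge0 ?rnorm_ge0.
have d0 : 0 < e / (rnorm x + rnorm y + 1) by rewrite divr_gt0.
have [N /(_ (maxn N _) (leq_maxl _ _)) uN] := ul _ d0.
have [M /(_ (maxn _ M) (leq_maxr _ _)) vM] := vk _ d0.
move: uN vM => /(_ M) uN /(_ N); set n := maxn N M in uN * => vM.
have -> : '[l, y] - '[x, k] = '[l - u n, y] + '[x, v n - k].
  by rewrite hdotBl hdotBr uv; ring.
apply: le_trans (Re_normD _ _) _.
apply: le_trans (lerD (Re_norm_hdot_le _ _) (Re_norm_hdot_le _ _)) _.
rewrite rnormB in vM.
apply: (@le_trans _ _ (e / (rnorm x + rnorm y + 1) * (rnorm x + rnorm y + 1))).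
  have := rnorm_ge0 x; have := rnorm_ge0 y; nra.
by rewrite divfK // gt_eqF.
Qed.

Lemma closure_rnorm (V : normedModType C) (A : set V) (x : V) :
  closure A x <-> forall e : R, 0 < e -> exists2 a, A a & rnorm (x - a) < e.
Proof.
split=> [cA e e0|cA B /nbhs_ballP[e /= /ltr0c_Re[r r0 ->]]].
  have eC : 0 < e%:C%C by rewrite ltcR.
  have [a [Aa]] := cA _ (nbhsx_ballx x _ eC).
  by rewrite -ball_normE /= rnormE ltcR => xa; exists a.
have [a Aa xa] := cA _ r0.
by move/(_ a); rewrite -ball_normE /= rnormE ltcR => /(_ xa) Ba; exists a.
Qed.

End Limits.

Section Adjoint.
Variable R : realType.
Local Notation C := R[i].

Lemma contractive_rnorm (H K : hilbertType C) (A : 'B(H, K)) :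
  contractive A -> forall x, rnorm (A x) <= rnorm x.
Proof. by move=> cA x; rewrite -lecR -!rnormE. Qed.

Lemma isometric_contractive (H K : hilbertType C) (A : 'B(H, K)) :
  isometric A -> contractive A.
Proof. by move=> iA x; rewrite iA. Qed.

(** Divide [|B x|^2 = <A (B x), x> <= |B x| |x|] by [|B x|]. As [B] is a plain function, the bound
    is available before [B] is known to be an operator. *)
Lemma adjoint_contractive (H K : hilbertType C) (A : 'B(H, K)) (B : K -> H) :
  contractive A -> (forall x y, '[A x, y] = '[x, B y]) ->
  forall x, `|B x| <= `|x|.
Proof.
move=> cA AB x; rewrite !rnormE lecR; have [->|g0] := eqVneq (B x) 0.
  by rewrite rnorm0 rnorm_ge0.
have n0 : 0 < rnorm (B x).
  by rewrite lt_def rnorm_ge0 andbT; apply: contra_neq g0 => /rnorm0_eq0.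
rewrite -(ler_pM2l n0) -expr2; apply: (@le_trans _ _ (rnorm (A (B x)) * rnorm x)).
  apply: le_trans (Re_norm_hdot_le (A (B x)) x).
  rewrite AB hdot_rnorm ger0_norm ?ler0c ?exprn_ge0 ?rnorm_ge0 //=.
by rewrite ler_wpM2r ?rnorm_ge0 ?contractive_rnorm.
Qed.

(** The value at [y] represents the functional [<A ., y>]; linearity follows because a vector is
    determined by its inner products. *)
Lemma contractive_adjoint_exists (H K : hilbertType C) (A : 'B(H, K)) :
  contractive A -> exists B, is_adjoint A B.
Proof.
move=> cA; have [y|g gA] := @choice K H (fun y u => forall x, '[A x, y] = '[x, u]).
  apply: (@riesz R H (fun x => '[A x, y]) (rnorm y)).
    by move=> a x x'; rewrite linearP hdotDl hdotZl.
  move=> x; apply: le_trans (Re_norm_hdot_le _ _) _; rewrite mulrC.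
  by rewrite ler_wpM2l ?rnorm_ge0 ?contractive_rnorm.
have Ag x y : '[A x, y] = '[x, g y] by exact: gA.
have lg : linear g.
  move=> a x y; apply: hdot_inj => z.
  by rewrite -Ag !hdotDr !hdotZr !Ag.
have cg := adjoint_contractive cA Ag.
by have [B Bg] := bounded_operator_contr lg cg; exists B => x y; rewrite Bg.
Qed.

Lemma adjointP (H K : hilbertType C) (A : 'B(H, K)) :
  contractive A -> is_adjoint A (adjoint A).
Proof. by move=> /contractive_adjoint_exists[B AB]; exact: (xgetI _ AB). Qed.

(** The Riesz theorem inside the Hilbert space [S] yields the orthogonal projection [u] of [x] on
    [S]; then [x - u] is orthogonal to [S], hence zero. *)
Lemma closed_subspace_full (H : hilbertType C) (S : closedSubspace H) :
  (forall y, (forall x, (S : set H) x -> '[x, y] = 0) -> y = 0) ->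
  forall x, (S : set H) x.
Proof.
move=> S0 x; have [||u xu] := @riesz R (subspace_type S) (fun s => '[val s, x]) (rnorm x).
- by move=> a s t; rewrite linearP hdotDl hdotZl.
- move=> s; apply: le_trans (Re_norm_hdot_le _ _) _; rewrite mulrC.
  by rewrite /rnorm subspace_norm.
suff -> : x = val u by have := valP u; rewrite inE.
apply/eqP; rewrite -subr_eq0; apply/eqP/S0 => s Ss.
have Ss' : s \in (S : set H) by rewrite inE.
by have := xu (exist _ s Ss'); rewrite hdotBr /= => ->; rewrite subrr.
Qed.

(** Polarization: the norm of [x + y] gives the real part, and replacing [y] by [i y] gives the
    imaginary part. *)
Lemma isometric_hdot (H K : hilbertType C) (W : 'B(H, K)) : isometric W ->
  forall x y, '[W x, W y] = '[x, y].
Proof.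
move=> iW; have rW x : rnorm (W x) = rnorm x by rewrite /rnorm iW.
have RW x y : complex.Re '[W x, W y] = complex.Re '[x, y].
  have := rW (x + y); rewrite linearD => /(congr1 (fun t => t ^+ 2)).
  rewrite !rnorm2D !rW; lra.
move=> x y; have := RW x (('i%C : C) *: y); have := RW x y.
rewrite linearZ !hdotZr; case: '[W x, W y] '[x, y] => a b [a' b'] /= -> h.
by apply/eqP; rewrite eq_complex /= eqxx /=; apply/eqP; move: h; lra.
Qed.

(** With [B] the adjoint of [W], the vector [y - W (B y)] is orthogonal to the range of [W]. *)
Lemma isometric_onto (H K : hilbertType C) (W : 'B(H, K)) : isometric W ->
  (forall y, (forall x, '[W x, y] = 0) -> y = 0) -> onto W.
Proof.
move=> iW W0; apply/seteqP; split=> // y _.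
have [B WB] := contractive_adjoint_exists (isometric_contractive iW).
exists (B y) => //; apply/esym/eqP; rewrite -subr_eq0; apply/eqP/W0 => x.
by rewrite hdotBr WB isometric_hdot // subrr.
Qed.

Lemma dense_range (H : normedModType C) (D : hilbertType C) (j : 'B(H, D)) :
  (forall y, (forall h, '[j h, y] = 0) -> y = 0) -> closure (range j) = setT.
Proof.
move=> j0; apply/seteqP; split=> // y _.
apply: (@closed_subspace_full _ (closed_range j)) => z z0; apply: j0 => h.
by apply: z0; apply: subset_closure; exists h.
Qed.

Lemma hsum_rnorm (H K : hilbertType C) (x : hsum H K) :
  rnorm x ^+ 2 = rnorm x.1 ^+ 2 + rnorm x.2 ^+ 2.
Proof.
by apply: complexI; rewrite rmorphD !rmorphXn /= -!rnormE hsum_norm.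
Qed.

Lemma hsum_rnorm1 (H K : hilbertType C) (x : hsum H K) : rnorm x.1 <= rnorm x.
Proof.
by rewrite -ler_sqr ?nnegrE ?rnorm_ge0 // hsum_rnorm lerDl exprn_ge0 ?rnorm_ge0.
Qed.

Lemma hsum_rnorm2 (H K : hilbertType C) (x : hsum H K) : rnorm x.2 <= rnorm x.
Proof.
by rewrite -ler_sqr ?nnegrE ?rnorm_ge0 // hsum_rnorm lerDr exprn_ge0 ?rnorm_ge0.
Qed.

Lemma hsum_rnorm_le (H K : hilbertType C) (x : hsum H K) :
  rnorm x <= rnorm x.1 + rnorm x.2.
Proof.
rewrite -ler_sqr ?nnegrE ?addr_ge0 ?rnorm_ge0 // hsum_rnorm.
have := rnorm_ge0 x.1; have := rnorm_ge0 x.2; nra.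
Qed.

End Adjoint.

(** * Positive square roots *)

Section SquareRoot.
Variables (R : realType) (H : hilbertType R[i]) (B : H -> H).
Local Notation C := R[i].
Hypothesis B_linear : linear B.
Hypothesis B_contr : forall x, rnorm (B x) <= rnorm x.
Hypothesis B_sym : forall x y, '[B x, y] = '[x, B y].

(* [1 - S] is a square root of [1 - B] when [S = (B + S ^ 2) / 2].  The iterates
   below converge in norm because their increments are dominated by those of the
   scalar sequence [sqrt_bound], which increases to a limit at most 1. *)
Fixpoint sqrt_bound (n : nat) : R :=
  if n is n'.+1 then (1 + sqrt_bound n' ^+ 2) / 2 else 0.

Fixpoint sqrt_iter (n : nat) : H -> H :=
  if n is n'.+1 then fun x => (2^-1 : C) *: (B x + sqrt_iter n' (sqrt_iter n' x))
  else fun=> 0.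

Local Notation y := sqrt_bound.
Local Notation Y := sqrt_iter.

Let y01 n : 0 <= y n <= 1.
Proof. by elim: n => [|n /andP[? ?]] /=; [rewrite lexx ler01|apply/andP; split; nra]. Qed.

Let y_nondec n : y n <= y n.+1.
Proof.
have := sqr_ge0 (1 - y n); rewrite /=; nra.
Qed.

Let half_norm : complex.Re `|2^-1 : C| = 2^-1.
Proof.
by rewrite ger0_norm ?invr_ge0// -[2]/(2%:R) -(rmorph_nat (real_complex R)) -fmorphV.
Qed.

Let Y_linear n : linear (Y n).
Proof.
elim: n => [|n IH] a x z /=; first by rewrite scaler0 addr0.
rewrite B_linear !IH scalerA mulrC -scalerA -scalerDr; congr (_ *: _).
by rewrite addrACA -scalerDr.
Qed.

Let YB n x z : Y n (x - z) = Y n x - Y n z.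
Proof. by rewrite -scaleN1r addrC Y_linear scaleN1r addrC. Qed.

Let Y_bound n x : rnorm (Y n x) <= y n * rnorm x.
Proof.
elim: n x => [|n IH] x /=; first by rewrite rnorm0 mul0r.
rewrite rnormZ half_norm; have := rnormD (B x) (Y n (Y n x)).
have := B_contr x; have := IH (Y n x); have := IH x; have := y01 n.
have := rnorm_ge0 x; move: (y n) => t; nra.
Qed.

Let Y_step n x : rnorm (Y n.+1 x - Y n x) <= (y n.+1 - y n) * rnorm x.
Proof.
elim: n x => [|n IH] x.
  rewrite /= subr0 addr0 rnormZ half_norm; have := B_contr x; lra.
(* The identity [S^2 - T^2 = S (S - T) + (S - T) T] for consecutive iterates; its scalar version
   gives the increments of [y]. *)
have -> : Y n.+2 x - Y n.+1 x =
    (2^-1 : C) *: (Y n.+1 (Y n.+1 x - Y n x) + (Y n.+1 (Y n x) - Y n (Y n x))).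
  have -> : Y n.+2 x = (2^-1 : C) *: (B x + Y n.+1 (Y n.+1 x)) by [].
  have -> : Y n.+1 x = (2^-1 : C) *: (B x + Y n (Y n x)) by [].
  rewrite -scalerBr; congr (_ *: _); rewrite YB.
  by rewrite addrA subrK opprD addrACA subrr add0r.
rewrite rnormZ half_norm.
have := rnormD (Y n.+1 (Y n.+1 x - Y n x)) (Y n.+1 (Y n x) - Y n (Y n x)).
have := Y_bound n.+1 (Y n.+1 x - Y n x); have := IH x; have := IH (Y n x).
have := Y_bound n x; have := y01 n; have := y01 n.+1; have := y_nondec n.
have := rnorm_ge0 x; have -> : y n.+2 = (1 + y n.+1 ^+ 2) / 2 by [].
have : y n.+1 = (1 + y n ^+ 2) / 2 by [].
move: (y n.+1) (y n) => s t st x0 ts s01 t01 h1 h2 h3 h4 h5.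
have e1 : s * rnorm (Y n.+1 x - Y n x) <= s * ((s - t) * rnorm x).
  by rewrite ler_wpM2l //; case/andP: s01.
have e2 : (s - t) * rnorm (Y n x) <= (s - t) * (t * rnorm x).
  by rewrite ler_wpM2l // subr_ge0.
nra.
Qed.

Let Y_cauchy n k x : rnorm (Y (n + k) x - Y n x) <= (y (n + k) - y n) * rnorm x.
Proof.
elim: k => [|k IH]; first by rewrite addn0 !subrr rnorm0 mul0r.
rewrite addnS; have := rnormD (Y (n + k).+1 x - Y (n + k) x) (Y (n + k) x - Y n x).
rewrite addrA subrK; have := Y_step (n + k) x; move: IH.
move: (y (n + k)) (y (n + k).+1) (y n) => a b c; nra.
Qed.

Let Y_cvg x : exists l : H, Y n x @[n --> \oo] --> l.
Proof.
have [|l lx] := @rnorm_seq_cvg R H (fun n => Y n x); last first.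
  by exists l; apply/cvg_rnorm.
move=> e e0; pose E := range y.
have Es : has_sup E.
  split; first by exists (y 0), 0.
  by exists 1 => _ [n _ <-]; have /andP[] := y01 n.
have x1 : 0 < rnorm x + 1 by rewrite ltr_wpDl ?rnorm_ge0.
have d0 : 0 < e / (rnorm x + 1) / 2 by rewrite !divr_gt0.
have [_ [N _ <-] yN] := sup_adherent d0 Es.
exists N => m n Nm Nn.
have key k : (N <= k)%N -> rnorm (Y k x - Y N x) <= e / (rnorm x + 1) / 2 * rnorm x.
  move=> /subnKC <-; apply: le_trans (Y_cauchy _ _ _) _.
  rewrite ler_wpM2r ?rnorm_ge0 //.
  have : y (N + (k - N)) <= sup E by apply: ub_le_sup; [exact: Es.2|exists (N + (k - N))%N].
  lra.
have := rnormD (Y m x - Y N x) (Y N x - Y n x); rewrite addrA subrK.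
have := key _ Nm; have := key _ Nn; rewrite [rnorm (Y N x - _)]rnormB => h1 h2 h3.
apply: le_lt_trans h3 _; apply: le_lt_trans (lerD h2 h1) _.
have : e / (rnorm x + 1) * (rnorm x + 1) = e by rewrite divfK // gt_eqF.
have : 0 < e / (rnorm x + 1) by rewrite divr_gt0.
move: (e / _) => d; lra.
Qed.

(** The pointwise limit [S] of the iterates is a symmetric contraction, so [<x - S x, x> >= 0]. The
    limit equation, read as [B = 2 S - S^2], gives [(1 - S)^2 = 1 - B]. *)
Lemma positive_sqrt_exists :
  exists D : 'B(H, H), positive_operator D /\ D \o D =1 (fun x => x - B x).
Proof.
have [S YS] := choice Y_cvg.
have S_linear : linear S.
  move=> a x z; apply: norm_cvg_unique (YS (a *: x + z)) _ => /=.
  rewrite (_ : (fun n => Y n (a *: x + z)) = (fun n => a *: Y n x + Y n z)).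
    by apply: cvgD; [apply: cvgZ; first exact: cvg_cst|]; exact: YS.
  by apply/funext => n; rewrite Y_linear.
have S_contr x : rnorm (S x) <= rnorm x.
  apply: (rnorm_le_cvg (YS x)) => n; apply: le_trans (Y_bound _ _) _.
  by rewrite ler_piMl ?rnorm_ge0 //; have /andP[] := y01 n.
have SB x z : S (x - z) = S x - S z.
  by rewrite -scaleN1r addrC S_linear scaleN1r addrC.
have Y_sym n x z : '[Y n x, z] = '[x, Y n z].
  elim: n x z => [|n IH] x z /=; first by rewrite hdot0l hdot0r.
  rewrite hdotZl hdotZr hdotDl hdotDr B_sym !IH; congr (_ * _).
  by rewrite geC0_conj // invr_ge0.
have S_sym x z : '[S x, z] = '[x, S z].
  by apply: hdot_eq_cvg (YS x) (YS z) _ => n; exact: Y_sym.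
have S_eq x : S x = (2^-1 : C) *: (B x + S (S x)).
  apply: norm_cvg_unique (YS x) _ => /=; rewrite -cvg_shiftS /=.
  apply: cvgZ; first exact: cvg_cst.
  apply: cvgD; first exact: cvg_cst.
  (* In [Y n (Y n x)] both the operator and its argument vary; the uniform bound [y n <= 1] controls
     the change of argument. *)
  apply/cvg_rnorm => e e0; have e20 : 0 < e / 2 by rewrite divr_gt0.
  have /cvg_rnorm/(_ _ e20)[N YN] := YS (S x).
  have /cvg_rnorm/(_ _ e20)[M YM] := YS x.
  exists (maxn N M) => n; rewrite geq_max => /andP[/YN h1 /YM h2].
  have -> : S (S x) - Y n (Y n x) = (S (S x) - Y n (S x)) + Y n (S x - Y n x).
    by rewrite YB addrA subrK.
  apply: le_lt_trans (rnormD _ _) _; have := Y_bound n (S x - Y n x).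
  have := y01 n; have := rnorm_ge0 (S x - Y n x); nra.
have D_linear : linear (fun x => x - S x).
  by move=> a x z; rewrite S_linear scalerBr opprD addrACA.
have [D DE] : exists D : 'B(H, H), D =1 (fun x => x - S x).
  apply: (@bounded_operatorP _ _ _ _ 2) => // x.
  rewrite !rnormE -[2]/(2%:R) -(rmorph_nat (real_complex R)) -rmorphM lecR.
  have := rnormD x (- S x); have := rnormB (S x) 0; rewrite subr0 sub0r => <-.
  have := S_contr x; lra.
exists D; split=> x.
  rewrite DE hdotBl hdot_rnorm.
  have : '[S x, x] \is Num.real.
    by rewrite CrealE -hdotC S_sym.
  move/RRe_real => <-; rewrite -rmorphB ler0c subr_ge0.
  apply: le_trans (ler_norm _) _; apply: le_trans (Re_hdot_le _ _) _.
  by rewrite expr2 ler_wpM2r ?rnorm_ge0.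
rewrite /= !DE SB.
have -> : B x = S x + S x - S (S x).
  apply/eqP; rewrite eq_sym subr_eq; apply/eqP.
  rewrite [S x in LHS]S_eq -scalerDl.
  by rewrite -[2^-1]div1r -splitr scale1r.
by rewrite !opprD !opprK !addrA.
Qed.

End SquareRoot.

(** * Extension of isometries *)

Section Extension.
Variable R : realType.
Local Notation C := R[i].

(** Totality is expressed by orthogonality, the form that adjoints handle; for a bounded operator
    [dense_range] turns it into density of the range. *)
Definition total_map (T : Type) (D : hilbertType C) (j : T -> D) : Prop :=
  forall y, (forall t, '[j t, y] = 0) -> y = 0.

Lemma closure_ortho (D : hilbertType C) (A : set D) (x y : D) :
  closure A x -> (forall a, A a -> '[a, y] = 0) -> '[x, y] = 0.
Proof.
move=> /closure_rnorm cx Ay; apply: Re_norm_eq0; apply/eqP.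
rewrite eq_le Re_norm_ge0 andbT; apply/ler_addgt0Pr => /= e e0; rewrite add0r.
have y1 : 0 < rnorm y + 1 by rewrite ltr_wpDl ?rnorm_ge0.
have d0 : 0 < e / (rnorm y + 1) by rewrite divr_gt0.
have [a /Ay ay xa] := cx _ d0.
rewrite -[x](subrK a) hdotDl ay addr0; apply: le_trans (Re_norm_hdot_le _ _) _.
have : e / (rnorm y + 1) * (rnorm y + 1) = e by rewrite divfK // gt_eqF.
have := rnorm_ge0 y; have := rnorm_ge0 (x - a); nra.
Qed.

Section Extend.
Variables (H D K : hilbertType C) (j : H -> D) (B : H -> K).
Hypotheses (j_linear : linear j) (B_linear : linear B).
Hypotheses (j_contr : forall h, `|j h| <= `|h|) (j_total : total_map j).
Hypothesis Bj : forall h, `|B h| = `|j h|.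

Let rBj h : rnorm (B h) = rnorm (j h).
Proof. by rewrite /rnorm Bj. Qed.

Let jB x z : j (x - z) = j x - j z.
Proof. by rewrite -scaleN1r addrC j_linear scaleN1r addrC. Qed.

Let BB x z : B (x - z) = B x - B z.
Proof. by rewrite -scaleN1r addrC B_linear scaleN1r addrC. Qed.

Let graph_exists : exists P : 'B(H, hsum D K), P =1 (fun h => (j h, B h)).
Proof.
apply: (@bounded_operatorP _ _ _ _ 2) => //.
  by move=> a x y; rewrite j_linear B_linear.
move=> x; rewrite mulr_natl mulr2n !rnormE -rmorphD lecR.
apply: le_trans (hsum_rnorm_le _) _; rewrite /= rBj.
by apply: lerD; rewrite -lecR -!rnormE.
Qed.

(* The extension is the functional relation whose graph is the closure of
   [{(j h, B h)}]. *)
Lemma isometric_extension :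
  exists W : 'B(D, K), isometric W /\ forall h, W (j h) = B h.
Proof.
have [P PE] := graph_exists; pose G := closed_range P.
have [[G0 GP] _] := subspaceP G.
(* Equality of norms passes from the graph to its closure. Applied to a difference [(0, k)], it
   makes the relation single-valued. *)
have Gnorm d k : (G : set _) (d, k) -> rnorm d = rnorm k.
  move=> /closure_rnorm cG; suff : forall e : R, 0 < e -> `|rnorm d - rnorm k| <= e + e.
    move=> h; apply/eqP; rewrite -subr_eq0 -normr_eq0 eq_le normr_ge0 andbT.
    apply/ler_addgt0Pr => e e0; rewrite add0r [leRHS](splitr e).
    by apply: h; rewrite divr_gt0.
  move=> e /cG[_ [h _ <-]]; rewrite PE => dh.
  have h5 := le_lt_trans (hsum_rnorm1 _) dh.
  have h6 := le_lt_trans (hsum_rnorm2 _) dh.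
  move: h5 h6 => /=.
  have := rnormD (d - j h) (j h); have := rnormD (j h - d) d.
  have := rnormD (k - B h) (B h); have := rnormD (B h - k) k.
  rewrite !subrK rBj [rnorm (j h - d)]rnormB [rnorm (B h - k)]rnormB.
  rewrite ler_norml => h1 h2 h3 h4 h5 h6; apply/andP; split; lra.
(* By totality [d] is a limit of vectors [j (h n)]. The vectors [B (h n)] have the same mutual
   distances, hence converge as well. *)
have Gtot d : exists k, (G : set _) (d, k).
  have [J JE] := bounded_operator_contr j_linear j_contr.
  have cJ : closure (range J) d.
    by rewrite dense_range // => y h0; apply: j_total => t; rewrite -JE.
  have step (n : nat) : exists h, rnorm (d - j h) < n.+1%:R^-1.
    have n0 : 0 < n.+1%:R^-1 :> R by rewrite invr_gt0.
    have [_ [h _ <-] dh] := (closure_rnorm _ _).1 cJ _ n0.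
    by exists h; rewrite -JE.
  have [h dh] := choice step.
  have small (e : R) : 0 < e -> exists N, forall n, (N <= n)%N -> n.+1%:R^-1 < e.
    move=> e0; have [N _ Ne] := near_infty_natSinv_lt (PosNum e0).
    by exists N => n Nn; exact: Ne.
  have [|k /cvg_rnorm Bk] := @rnorm_seq_cvg R K (fun n => B (h n)).
    move=> e e0; have e20 : 0 < e / 2 by rewrite divr_gt0.
    have [N Ne] := small _ e20; exists N => m n /Ne me /Ne ne.
    rewrite -BB rBj jB.
    have -> : j (h m) - j (h n) = (j (h m) - d) + (d - j (h n)).
      by rewrite addrA subrK.
    apply: le_lt_trans (rnormD _ _) _; rewrite [rnorm (_ - d)]rnormB.
    have := lt_trans (dh m) me; have := lt_trans (dh n) ne.
    move: (rnorm _) (rnorm _) => ? ?; lra.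
  exists k; apply/closure_rnorm => e e0; have e20 : 0 < e / 2 by rewrite divr_gt0.
  have [N1 h1] := small _ e20; have [N2 h2] := (cvg_rnorm _ _).1 Bk _ e20.
  exists (P (h (maxn N1 N2))); first by exists (h (maxn N1 N2)).
  apply: le_lt_trans (hsum_rnorm_le _) _; rewrite PE /=.
  have := h2 _ (leq_maxr N1 N2).
  have := lt_trans (dh (maxn N1 N2)) (h1 _ (leq_maxl N1 N2)).
  move: (rnorm _) (rnorm _) => ? ?; lra.
have [W GW] := choice Gtot.
have GWu d k : (G : set _) (d, k) -> W d = k.
  move=> Gdk; apply/eqP; rewrite -subr_eq0; apply/eqP/rnorm0_eq0.
  have := GP (-1) (d, k) (d, W d); rewrite !inE => /(_ Gdk (GW d)).
  rewrite scaleN1r (_ : - (d, k) + (d, W d) = (0, W d - k) :> hsum D K).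
    by move=> /Gnorm <-; rewrite rnorm0.
  by rewrite -[RHS]/((0, W d - k)%R) -(subrr d) addrC.
have [V VW] : exists V : 'B(D, K), V =1 W.
  apply: bounded_operator_contr => [a x y|x]; last first.
    by rewrite !rnormE (Gnorm _ _ (GW x)).
  apply: GWu; have := GP a (x, W x) (y, W y); rewrite !inE.
  by apply; exact: GW.
exists V; split=> [x|h]; first by rewrite VW !rnormE (Gnorm _ _ (GW x)).
by rewrite VW; apply: GWu; apply: subset_closure; exists h => //; rewrite PE.
Qed.

Lemma unitary_extension : total_map B ->
  exists W : 'B(D, K), unitary W /\ forall h, W (j h) = B h.
Proof.
move=> B_total; have [W [iW WB]] := isometric_extension.
exists W; split=> //; split=> //; apply: isometric_onto => // y y0.
by apply: B_total => h; rewrite -WB.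
Qed.

End Extend.

Lemma onto_total (D K : hilbertType C) (H : Type) (j : H -> D) (W : 'B(D, K)) :
  total_map j -> isometric W -> onto W -> total_map (W \o j).
Proof.
move=> tj iW oW y Wy; have : [set: K] y by [].
rewrite -oW => -[x _ xy]; rewrite -xy (tj x) ?linear0 // => h.
by rewrite -(isometric_hdot iW) xy; exact: Wy.
Qed.

End Extension.

(** * Defect operators and defect spaces *)

Section DefectFacts.
Variables (R : realType) (H : hilbertType R[i]).
Local Notation C := R[i].

(** The form is real at [x + y], which matches the imaginary parts, and at [x + i y], which matches
    the real parts. *)
Lemma positive_operator_sym (D : 'B(H, H)) : positive_operator D -> is_adjoint D D.
Proof.
move=> pD x y; have real z : complex.Im '[D z, z] = 0 by exact/ger0_Im/pD.
have h1 := real (x + y); have h2 := real (x + ('i%C : C) *: y).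
have hx := real x; have hy := real y.
have DZ : D (('i%C : C) *: y) = ('i%C : C) *: D y by rewrite linearZ.
have DD z : D (x + z) = D x + D z by rewrite linearD.
move: h1 h2; rewrite !DD DZ !hdotDl !hdotDr !hdotZl !hdotZr.
rewrite (hdotC x (D y)) !raddfD /= hx hy.
case: '[D x, y] '[D y, x] '[D y, y] hy => a b [a' b'] [p q] /= -> h1 h2.
by apply/eqP; rewrite eq_complex /=; apply/andP; split; apply/eqP; lra.
Qed.

Variable A : 'B(H, H).
Hypothesis A_contr : contractive A.

(** [A^* A] is a symmetric contraction, so a positive root of [1 - A^* A] exists and [operator_sqrt]
    does not fall back on its default. *)
Lemma defectP : positive_operator (defect A) /\
  defect A \o defect A =1 (fun x => x - adjoint A (A x)).
Proof.
have AA := adjointP A_contr; have cAA := adjoint_contractive A_contr AA.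
have [|||D DP] := @positive_sqrt_exists R H (fun x => adjoint A (A x)).
- by move=> a x y; rewrite !linearP.
- move=> x; rewrite -lecR -!rnormE; exact: le_trans (cAA _) (A_contr x).
- by move=> x y; rewrite -AA hdotC -AA -hdotC.
exact: (@xgetI _ _ [set B | _] D DP).
Qed.

Lemma norm2_defect h : `|defect A h| ^+ 2 = `|h| ^+ 2 - `|A h| ^+ 2.
Proof.
have [/positive_operator_sym sD DD] := defectP.
rewrite -!hdot_norm -sD [defect A _]DD hdotBl (hdotC (adjoint A _)).
by rewrite -adjointP // -hdotC.
Qed.

Lemma norm_to_defect_space h : `|to_defect_space A h| = `|defect A h|.
Proof. by rewrite subspace_norm. Qed.

Lemma norm2_to_defect_space h :
  `|to_defect_space A h| ^+ 2 = `|h| ^+ 2 - `|A h| ^+ 2.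
Proof. by rewrite norm_to_defect_space norm2_defect. Qed.

Lemma to_defect_space_linear : linear (to_defect_space A).
Proof. by move=> a x y; apply: val_inj; rewrite linearP /= linearP. Qed.

Lemma to_defect_space_contr h : `|to_defect_space A h| <= `|h|.
Proof.
by rewrite -ler_sqr ?nnegrE // norm2_to_defect_space lerBlDr lerDl exprn_ge0.
Qed.

Lemma to_defect_space_total : total_map (to_defect_space A).
Proof.
move=> y y0; apply: val_inj; apply: hdotxx_eq0.
have := valP y; rewrite inE => cy; apply: closure_ortho cy _ => _ [h _ <-].
exact: y0.
Qed.

End DefectFacts.

(** * Square-summable sequences *)

Section ComplexSums.
Variable R : realType.
Local Notation C := R[i].
Implicit Types (u v : nat -> C) (s t : C).

(* Stated with real limits, as the library has no completeness theorem for
   [R[i]]. *)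
Definition has_sum u s : Prop :=
  series (fun k => complex.Re (u k)) @ \oo --> complex.Re s /\
  series (fun k => complex.Im (u k)) @ \oo --> complex.Im s.

Lemma has_sum_unique u s t : has_sum u s -> has_sum u t -> s = t.
Proof.
move=> [us1 us2] [ut1 ut2].
have := norm_cvg_unique us1 ut1; have := norm_cvg_unique us2 ut2.
by case: s t {us1 us2 ut1 ut2} => a b [c d] /= -> ->.
Qed.

(** The real and imaginary parts of [a * u + v] both have this shape. *)
Lemma series_lin3_cvg (b c : R) (w x y z : nat -> R) (lx ly lz : R) :
  (forall k, w k = b * x k + c * y k + z k) ->
  series x @ \oo --> lx -> series y @ \oo --> ly -> series z @ \oo --> lz ->
  series w @ \oo --> b * lx + c * ly + lz.
Proof.
move=> wE cx cy cz.
have -> : series w = (fun n => b * series x n + c * series y n + series z n).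
  apply/funext => n; rewrite /series /= !mulr_sumr -!big_split /=.
  by apply: eq_bigr => k _; rewrite wE.
by apply: cvgD => //; apply: cvgD; apply: cvgM => //; exact: cvg_cst.
Qed.

Lemma has_sumP a u v s t : has_sum u s -> has_sum v t ->
  has_sum (fun k => a * u k + v k) (a * s + t).
Proof.
have ReE (x y z : C) : complex.Re (x * y + z) =
    complex.Re x * complex.Re y + - complex.Im x * complex.Im y + complex.Re z.
  by case: x y z => ? ? [? ?] [? ?] /=; rewrite mulNr.
have ImE (x y z : C) : complex.Im (x * y + z) =
    complex.Re x * complex.Im y + complex.Im x * complex.Re y + complex.Im z.
  by case: x y z => ? ? [? ?] [? ?] /=.
move=> [us1 us2] [vt1 vt2]; split; rewrite ?ReE ?ImE.
  by apply: series_lin3_cvg us1 us2 vt1 => k; exact: ReE.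
by apply: series_lin3_cvg us2 us1 vt2 => k; exact: ImE.
Qed.

Lemma has_sum_conj u s : has_sum u s -> has_sum (fun k => (u k)^*) s^*.
Proof.
have ReE (x : C) : complex.Re x^* = complex.Re x by case: x.
have ImE (x : C) : complex.Im x^* = - complex.Im x by case: x.
move=> [us1 us2]; split; rewrite ?ReE ?ImE.
  by rewrite (_ : (fun k => _) = fun k => complex.Re (u k)) //; apply/funext.
rewrite (_ : (fun k => _) = - (fun k => complex.Im (u k))).
  by rewrite seriesN; exact: cvgN.
by apply/funext.
Qed.

Lemma series_cvg_bound (x y : nat -> R) (M : R) :
  (forall k, `|x k| <= y k) -> (forall n, series y n <= M) -> cvgn (series x).
Proof.
move=> xy yM; apply: normed_cvg; apply: nondecreasing_is_cvgn.
  by apply: nondecreasing_series => n _ _; exact: normr_ge0.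
exists M => _ [n _ <-]; apply: le_trans (yM n).
by rewrite /series /=; apply: ler_sum => k _; exact: xy.
Qed.

Lemma has_sum_exists u (y : nat -> R) (M : R) :
  (forall k, complex.Re `|u k| <= y k) -> (forall n, series y n <= M) ->
  exists s, has_sum u s.
Proof.
move=> uy yM.
have /cvg_ex[a ua] : cvgn (series (fun k => complex.Re (u k))).
  apply: (series_cvg_bound (y := y) (M := M)) => // k; apply: le_trans (uy k).
  by rewrite -lecR -Re_normE normc_ge_Re.
have /cvg_ex[b ub] : cvgn (series (fun k => complex.Im (u k))).
  apply: (series_cvg_bound (y := y) (M := M)) => // k; apply: le_trans (uy k).
  rewrite -(ler_pXn2r (n := 2)) ?nnegrE ?Re_norm_ge0 // sqr_Re_norm real_normK ?num_real //.
  by rewrite lerDr sqr_ge0.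
by exists (a +i* b)%C.
Qed.

End ComplexSums.

Section Ell2.
Variables (R : realType) (F : hilbertType R[i]).
Local Notation C := R[i].

(** For nonnegative terms, bounded partial sums amount to convergence and are easier to verify. *)
Definition square_summable : set (nat -> F) :=
  [set f | exists M, forall n, series (fun k => rnorm (f k) ^+ 2) n <= M].

Lemma square_summable_submod : submod_closed (fun f => f \in square_summable).
Proof.
split.
  rewrite inE; exists 0 => n; rewrite /series /= big1 // => k _.
  by rewrite rnorm0 expr0n.
move=> a f g; rewrite !inE => -[M fM] [N gN].
(* The constants come from [(y + z)^2 <= 2 y^2 + 2 z^2]. *)
exists (2 * complex.Re `|a| ^+ 2 * M + 2 * N) => n.
apply: (@le_trans _ _ (2 * complex.Re `|a| ^+ 2 * series (fun k => rnorm (f k) ^+ 2) n +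
    2 * series (fun k => rnorm (g k) ^+ 2) n)).
  rewrite /series /= !mulr_sumr -big_split /=; apply: ler_sum => k _.
  have := rnormD (a *: f k) (g k); rewrite rnormZ.
  have := rnorm_ge0 (a *: f k + g k).
  set x := rnorm _; set y := _ * _; set z := rnorm _ => x0 xyz.
  have -> : 2 * complex.Re `|a| ^+ 2 * rnorm (f k) ^+ 2 = 2 * y ^+ 2 by rewrite /y; ring.
  apply: (@le_trans _ _ ((y + z) ^+ 2)).
    by rewrite ler_pXn2r ?nnegrE // (le_trans x0).
  have := sqr_ge0 (y - z); nra.
apply: lerD; apply: ler_wpM2l.
all: by rewrite ?mulr_ge0 ?Re_norm_ge0.
Qed.

Definition ell2 : Type := {f : nat -> F | f \in square_summable}.

HB.instance Definition _ := SubChoice.on ell2.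
HB.instance Definition _ :=
  GRing.SubChoice_isSubLmodule.Build C (nat -> F) (fun f => f \in square_summable) ell2
    (GRing.submod_closed_semi square_summable_submod).

Lemma ell2_dot_exists (x y : ell2) :
  exists s, has_sum (fun k => '[val x k, val y k]) s.
Proof.
have := valP x; have := valP y; rewrite !inE => -[N yN] [M xM].
apply: (has_sum_exists (y := fun k => rnorm (val x k) ^+ 2 + rnorm (val y k) ^+ 2)
  (M := M + N)).
  move=> k; apply: le_trans (Re_norm_hdot_le _ _) _.
  have := rnorm_ge0 (val x k); have := rnorm_ge0 (val y k); nra.
move=> n; rewrite /series /= big_split /=; apply: lerD; [exact: xM|exact: yN].
Qed.

Definition ell2_dot (x y : ell2) : C := xget 0 (has_sum (fun k => '[val x k, val y k])).

Lemma ell2_dotP (x y : ell2) : has_sum (fun k => '[val x k, val y k]) (ell2_dot x y).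
Proof. by have [s /(xgetI 0)] := ell2_dot_exists x y. Qed.

Lemma ell2_dotE x y s : has_sum (fun k => '[val x k, val y k]) s -> ell2_dot x y = s.
Proof. exact: has_sum_unique (ell2_dotP x y). Qed.

Lemma ell2_dot_bilinear : bilinear_for ( *%R : GRing.Scale.law C C)
  ((@Num.conj C \; *%R) : GRing.Scale.law C C) ell2_dot.
Proof.
split=> u a x y; apply: ell2_dotE.
  rewrite (_ : (fun k => _) = (fun k => a * '[val x k, val u k] + '[val y k, val u k])).
    by apply: has_sumP; exact: ell2_dotP.
  by apply/funext => k; rewrite linearP hdotDl hdotZl.
rewrite (_ : (fun k => _) = (fun k => a^* * '[val u k, val x k] + '[val u k, val y k])).
  by apply: has_sumP; exact: ell2_dotP.
by apply/funext => k; rewrite [val (_ + _)]linearP hdotDr hdotZr.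
Qed.

HB.instance Definition _ :=
  bilinear_isBilinear.Build C ell2 ell2 C *%R (@Num.conj C \; *%R) ell2_dot
    ell2_dot_bilinear.

Lemma ell2_dot_hermitian x y :
  ell2_dot x y = (-1) ^+ false * (ell2_dot y x)^*.
Proof.
rewrite expr0 mul1r; apply: ell2_dotE.
rewrite (_ : (fun k => _) = (fun k => '[val y k, val x k]^*)).
  by apply: has_sum_conj; exact: ell2_dotP.
by apply/funext => k; rewrite hdotC.
Qed.

HB.instance Definition _ :=
  isHermitianSesquilinear.Build C ell2 false (@Num.conj C) ell2_dot
    ell2_dot_hermitian.

Lemma ell2_dotxx x : complex.Im (ell2_dot x x) = 0 /\
  series (fun k => rnorm (val x k) ^+ 2) @ \oo --> complex.Re (ell2_dot x x).
Proof.
have [xRe xIm] := ell2_dotP x x; split.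
  apply: norm_cvg_unique xIm _ => /=.
  rewrite (_ : series _ = fun=> 0); first exact: cvg_cst.
  apply/funext => n; rewrite /series /= big1 // => k _; by rewrite hdot_rnorm.
rewrite (_ : (fun k => _) = (fun k => complex.Re '[val x k, val x k])) //.
by apply/funext => k; rewrite hdot_rnorm.
Qed.

Lemma series_sqr_nondec (f : nat -> F) :
  nondecreasing_seq (series (fun k => rnorm (f k) ^+ 2)).
Proof. by apply: nondecreasing_series => n _ _; exact: sqr_ge0. Qed.

Lemma ell2_dot_ge x n : series (fun k => rnorm (val x k) ^+ 2) n <= complex.Re (ell2_dot x x).
Proof.
have [_ xx] := ell2_dotxx x; rewrite -(cvg_lim _ xx) //.
apply: nondecreasing_cvgn_le; first exact: series_sqr_nondec.
by apply/cvg_ex; exists (complex.Re (ell2_dot x x)).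
Qed.

Lemma term_le_series (f : nat -> F) k :
  rnorm (f k) ^+ 2 <= series (fun k => rnorm (f k) ^+ 2) k.+1.
Proof.
by rewrite /series /= big_nat_recr //= lerDr sumr_ge0 // => i _; exact: sqr_ge0.
Qed.

Lemma ell2_dot_gt0 x : x != 0 -> 0 < ell2_dot x x.
Proof.
move=> x0; have [im0 _] := ell2_dotxx x; rewrite ltcE /= im0 eqxx /= lt_def.
have ge0 := ell2_dot_ge x; apply/andP; split; last first.
  by have := ge0 0; rewrite /series /= big_geq.
apply: contra x0 => /eqP xx0; apply/eqP/val_inj/funext => k.
apply: rnorm0_eq0; apply/eqP; rewrite -sqrf_eq0 eq_le sqr_ge0 andbT -xx0.
exact: le_trans (term_le_series _ _) (ge0 _).
Qed.

HB.instance Definition _ := isDotProduct.Build C ell2 ell2_dot ell2_dot_gt0.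

HB.instance Definition _ := Lmodule_isPreHilbert.Build C ell2 ell2_dot.

Lemma ell2_rnorm (x : ell2) :
  series (fun k => rnorm (val x k) ^+ 2) @ \oo --> rnorm x ^+ 2.
Proof.
have [_] := ell2_dotxx x.
by rewrite (_ : ell2_dot x x = (rnorm x ^+ 2)%:C%C) // -hdot_rnorm.
Qed.

Lemma ell2_rnorm_ge (x : ell2) n :
  series (fun k => rnorm (val x k) ^+ 2) n <= rnorm x ^+ 2.
Proof.
have := ell2_dot_ge x n.
by rewrite (_ : ell2_dot x x = (rnorm x ^+ 2)%:C%C) // -hdot_rnorm.
Qed.

Lemma ell2_rnorm_le (x : ell2) (M : R) :
  (forall n, series (fun k => rnorm (val x k) ^+ 2) n <= M) -> rnorm x ^+ 2 <= M.
Proof. by move=> xM; apply: cvgr_to_le (@ell2_rnorm x) _; exact: nearW. Qed.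

Lemma ell2_term_le (x : ell2) k : rnorm (val x k) <= rnorm x.
Proof.
rewrite -ler_sqr ?nnegrE ?rnorm_ge0 //.
exact: le_trans (term_le_series _ _) (ell2_rnorm_ge _ _).
Qed.

Lemma cvg_rnormB (T : Type) (G : set_system T) (FG : Filter G) (f : T -> F) (l a : F) :
  f @ G --> l -> rnorm (f x - a) @[x --> G] --> rnorm (l - a).
Proof.
move=> fl; apply/cvgrPdist_lt => e e0; have eC : 0 < e%:C%C by rewrite ltcR.
have /cvgrPdist_lt/(_ _ eC) := fl; apply: filterS => x.
rewrite rnormE ltcR => lx.
have := rnormD (l - f x) (f x - a); have := rnormD (f x - l) (l - a).
rewrite !addrA !subrK [rnorm (f x - l)]rnormB => h1 h2.
rewrite ltr_norml; apply/andP; split; move: lx h1 h2.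
all: move: (rnorm _) (rnorm _) (rnorm _) => ? ? ?; lra.
Qed.

(** Coordinates are nonexpansive, so [G] converges coordinatewise to some [l]. If [a] lies in a set
    of [G] of diameter below [e], each partial sum for [l - a] is a limit of sums at most [e^2].
    Hence [l - a], and then [l], is square-summable, and [a] is within [e] of [l]. *)
Lemma ell2_complete (G : set_system ell2) : ProperFilter G -> cauchy G -> cvg G.
Proof.
move=> FG cG.
have comp k : exists l, val x k @[x --> G] --> (l : F).
  apply: (nonexpansive_cvg FG (p := fun x : ell2 => val x k)) => // x y.
  by rewrite !rnormE lecR; have := ell2_term_le (x - y) k; rewrite linearB.
have [l Gl] := choice comp.
have bnd (e : R) (A : set ell2) a : 0 < e -> G A -> A a ->
    (forall x y, A x -> A y -> rnorm (x - y) < e) ->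
    forall n, series (fun k => rnorm (l k - val a k) ^+ 2) n <= e ^+ 2.
  move=> e0 GA Aa dA n.
  apply: (@cvgr_to_le _ G _ _ (fun x => series (fun k => rnorm (val x k - val a k) ^+ 2) n)).
    elim: n => [|n IH].
      rewrite /series /= big_geq //.
      rewrite (_ : (fun x => _) = fun=> 0); first exact: cvg_cst.
      by apply/funext => x; rewrite big_geq.
    rewrite seriesSr; rewrite (_ : (fun x => _) = fun x : ell2 =>
       series (fun k => rnorm (val x k - val a k) ^+ 2) n + rnorm (val x n - val a n) ^+ 2); last first.
      by apply/funext => x; rewrite seriesSr.
    by apply: cvgD => //; rewrite expr2; apply: cvgM; exact: cvg_rnormB.
  apply: filterS GA => x Ax; apply: le_trans (_ : rnorm (x - a) ^+ 2 <= _).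
    exact: (ell2_rnorm_ge (x - a)).
  by rewrite ler_sqr ?nnegrE ?rnorm_ge0 ?(ltW e0) //; apply/ltW/dA.
have small (e : R) : 0 < e -> exists2 A, G A &
    forall x y, A x -> A y -> rnorm (x - y) < e.
  move=> e0; have e20 : 0 < (e / 2)%:C%C by rewrite ltcR divr_gt0.
  have /cauchyP/(_ _ e20)[z Gz] := cG.
  exists (ball z (e / 2)%:C%C) => // x y; rewrite -ball_normE /= !rnormE !ltcR.
  move=> zx zy; rewrite -(subrK z x) -addrA; apply: le_lt_trans (rnormD _ _) _.
  by rewrite (splitr e) rnormB; exact: ltrD.
have Sl : l \in square_summable.
  have [A GA dA] := small 1 ltr01; have [a Aa] := filter_ex GA.
  have sla : (l - val a) \in square_summable.
    by rewrite inE; exists (1 ^+ 2); exact: bnd ltr01 GA Aa dA.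
  have := square_summable_submod.2 1 _ _ sla (valP a).
  by rewrite scale1r subrK.
apply/cvg_ex; exists (exist _ l Sl : ell2); apply/fcvgrPdist_lt => _ /ltr0c_Re[e e0 ->].
have e20 : 0 < e / 2 by rewrite divr_gt0.
have [A GA dA] := small _ e20; apply: (filterS _ GA) => a Aa.
rewrite rnormE ltcR; apply: (@le_lt_trans _ _ (e / 2)); last lra.
rewrite -ler_sqr ?nnegrE ?rnorm_ge0 ?(ltW e20) //.
by apply: ell2_rnorm_le => n; exact: bnd e20 GA Aa dA n.
Qed.

HB.instance Definition _ := Uniform_isComplete.Build ell2 ell2_complete.

End Ell2.

(** * Regular factorizations and strongly minimal lifts *)

(** Rewrites the generators [V1^n V2^n] in strong minimality as powers of the single isometry
    [V1 V2]. *)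
Lemma iter_comp_comm (T : Type) (f g : T -> T) :
  f \o g =1 g \o f -> forall n x, iter n f (iter n g x) = iter n (f \o g) x.
Proof.
move=> fg; have swap n x : f (iter n g x) = iter n g (f x).
  by elim: n => //= n <-; exact: fg.
elim=> // n IH x; rewrite iterSr swap (iterSr _ g) IH [RHS]iterSr.
by congr (iter _ _ _); rewrite -[g (f x)]/((g \o f) x) -fg.
Qed.

Section Totality.
Variable R : realType.
Local Notation C := R[i].

(** The adjoint of [A] sends [x] to a vector orthogonal to a total family, hence to zero. *)
Lemma total_ext (T : Type) (D K : hilbertType C) (j : T -> D) (A : 'B(D, K)) x :
  total_map j -> contractive A -> (forall t, '[A (j t), x] = 0) ->
  forall d, '[A d, x] = 0.
Proof.
move=> tj cA Ax d; have [B AB] := contractive_adjoint_exists cA.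
by rewrite AB (tj (B x)) ?hdot0r // => t; rewrite -AB.
Qed.

Lemma eq_on_total (T : Type) (D K : hilbertType C) (j : T -> D) (A B : 'B(D, K)) :
  total_map j -> contractive A -> contractive B ->
  (forall t, A (j t) = B (j t)) -> A =1 B.
Proof.
move=> tj /contractive_adjoint_exists[A' AA] /contractive_adjoint_exists[B' BB] AB x.
apply/eqP; rewrite -subr_eq0; apply/eqP/hdotxx_eq0; rewrite {1}hdotBl AA BB -hdotBr.
rewrite [X in '[x, X]](tj _) ?hdot0r // => t.
by rewrite hdotBr -AA -BB AB subrr.
Qed.

End Totality.

Section Regular.
Variables (R : realType) (H : hilbertType R[i]).
Local Notation C := R[i].

Definition defect_pair (T' T'' : 'B(H, H)) (h : H) :
    hsum (defect_space T') (defect_space T'') :=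
  (to_defect_space T' (T'' h), to_defect_space T'' h).

Lemma defect_pair_linear (T' T'' : 'B(H, H)) : linear (defect_pair T' T'').
Proof.
by move=> a x y; rewrite /defect_pair linearP !to_defect_space_linear.
Qed.

Variables T T' T'' : 'B(H, H).
Hypotheses (T'_contr : contractive T') (T''_contr : contractive T'').
Hypothesis TE : T =1 T' \o T''.

Lemma eq_comp_contractive : contractive T.
Proof. by move=> x; rewrite TE; exact: le_trans (T'_contr _) (T''_contr _). Qed.

(** The squares telescope: [(|T'' h|^2 - |T h|^2) + (|h|^2 - |T'' h|^2) = |h|^2 - |T h|^2]. *)
Lemma norm_defect_pair h : `|defect_pair T' T'' h| = `|to_defect_space T h|.
Proof.
apply/eqP; rewrite -(eqrXn2 (n := 2)) // hsum_norm !norm2_to_defect_space //.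
  by rewrite TE addrC addrA subrK.
exact: eq_comp_contractive.
Qed.

(** By [norm_defect_pair] the isometry [Z] always exists. Being onto carries totality of [D_T h] to
    the pairs; conversely, totality of the pairs leaves nothing orthogonal to its range. *)
Lemma regular_factorizationP :
  regular_factorization T T' T'' <-> total_map (defect_pair T' T'').
Proof.
have tT := @to_defect_space_total _ _ T.
split=> [[_ [Z [iZ ZE oZ]]]|tp].
  by have := onto_total tT iZ oZ; congr total_map; apply/funext => h; exact: ZE.
split=> //; have [||||Z [[iZ oZ] ZE]] :=
  @unitary_extension _ _ _ _ (to_defect_space T) (defect_pair T' T'') _ _ _ tT _ tp.
- exact: to_defect_space_linear.
- exact: defect_pair_linear.
- exact/to_defect_space_contr/eq_comp_contractive.
- exact: norm_defect_pair.
by exists Z.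
Qed.

Lemma defect_pair_contr h : `|defect_pair T' T'' h| <= `|h|.
Proof.
by rewrite norm_defect_pair; exact/to_defect_space_contr/eq_comp_contractive.
Qed.

End Regular.

Section LiftTotal.
Variables (R : realType) (H K : hilbertType R[i]) (T1 T2 : 'B(H, H)).
Local Notation C := R[i].
Variables (Pi : 'B(H, K)) (V1 V2 : 'B(K, K)).
Hypotheses (T1_contr : contractive T1) (T2_contr : contractive T2).
Hypothesis lift : is_ando_lift T1 T2 Pi V1 V2.

(** All three claims rest on [<V x, Pi k> = <x, Pi (T^* k)>]. It yields
    [<V (Pi g), Pi k> = <T g, k>], so [V (Pi g) - Pi (T g)] has squared norm [|g|^2 - |T g|^2], that
    of [D_T g]. *)
Lemma lift_defect (T : 'B(H, H)) (V : 'B(K, K)) : contractive T -> isometric V ->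
  adjoint V \o Pi =1 Pi \o adjoint T ->
  [/\ forall x, (forall k, '[x, Pi k] = 0) -> forall k, '[V x, Pi k] = 0,
      forall g k, '[V (Pi g) - Pi (T g), Pi k] = 0 &
      exists W : 'B(defect_space T, K), isometric W /\
        forall g, W (to_defect_space T g) = V (Pi g) - Pi (T g)].
Proof.
move=> cT iV VT; have iP := ando_lift_Pi lift.
have VP x k : '[V x, Pi k] = '[x, Pi (adjoint T k)].
  by rewrite (adjointP (isometric_contractive iV)) [adjoint V _]VT.
have VPP g k : '[V (Pi g), Pi k] = '[T g, k].
  by rewrite VP isometric_hdot // -adjointP.
split=> [x x0 k|g k|]; first by rewrite VP.
  by rewrite hdotBl VPP isometric_hdot // subrr.
apply: (isometric_extension (j := to_defect_space T)).
- exact: to_defect_space_linear.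
- by move=> a x y; rewrite (linearP T) !(linearP Pi) (linearP V) scalerBr opprD addrACA.
- exact: to_defect_space_contr.
- exact: to_defect_space_total.
move=> h; apply/eqP; rewrite -(eqrXn2 (n := 2)) // norm2_to_defect_space //.
rewrite norm2B iV !iP VPP (hdotC (Pi (T h))) VPP -hdotC hdot_norm.
by apply/eqP; ring.
Qed.

(** The vectors orthogonal to [y] form a closed subspace; containing the generators, it is
    everything and contains [y]. *)
Lemma strongly_minimal_ortho (y : K) : strongly_minimal_lift Pi V1 V2 ->
  (forall n h, '[iter n (V1 \o V2) (Pi h), y] = 0) -> y = 0.
Proof.
move=> minP y0; apply: hdotxx_eq0; have : [set: K] y by [].
rewrite -minP => /(_ [set x | '[x, y] = 0]); apply; split.
  split.
    split; first by rewrite inE /= hdot0l.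
    by move=> a u v; rewrite !inE /= hdotDl hdotZl => -> ->; rewrite mulr0 addr0.
  move=> x cx /=; apply: closure_ortho cx _; by [].
move=> x [n _ [h _ <-]] /=; rewrite iter_comp_comm //.
exact: ando_lift_comm lift.
Qed.

(** Minimality enters through the powers of [V1 V2] only, a condition that survives the exchange of
    [V1] and [V2]; this serves both factorizations. *)
Lemma lift_defect_pair_total :
  (forall y, (forall n h, '[iter n (V1 \o V2) (Pi h), y] = 0) -> y = 0) ->
  total_map (defect_pair T1 T2).
Proof.
move=> minP; have iP := ando_lift_Pi lift.
have [iV1 iV2] := (ando_lift_V1 lift, ando_lift_V2 lift).
have [o1 e1 [W1 [iW1 W1E]]] := lift_defect T1_contr iV1 (ando_lift_T1 lift).
have [o2 e2 [W2 [iW2 W2E]]] := lift_defect T2_contr iV2 (ando_lift_T2 lift).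
have t1 := @to_defect_space_total _ _ T1; have t2 := @to_defect_space_total _ _ T2.
have ext1 x : (forall g, '[V1 (Pi g) - Pi (T1 g), x] = 0) -> forall d, '[W1 d, x] = 0.
  move=> gx; apply: (total_ext t1) => [|g]; first exact: isometric_contractive.
  by rewrite W1E.
have iVW : isometric (V1 \o W2 : 'B(_, _)) by move=> x /=; rewrite iV1 iW2.
have ext2 x : (forall g, '[V1 (V2 (Pi g) - Pi (T2 g)), x] = 0) ->
    forall r, '[V1 (W2 r), x] = 0.
  move=> gx; apply: (total_ext (A := V1 \o W2 : 'B(_, _)) t2) => [|g].
    exact: isometric_contractive.
  by rewrite /= W2E.
(* By totality it suffices to pair [V1 Pi g - Pi T1 g] with [V1 (V2 Pi h - Pi T2 h)]. Cancelling
   [V1] in the first term, both terms pair [Ran Pi] with its orthogonal complement. *)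
have cross d r : '[W1 d, V1 (W2 r)] = 0.
  apply: ext1 => g; apply: hdot_eq0C; apply: ext2 => h; apply: hdot_eq0C.
  rewrite hdotBl isometric_hdot // (hdot_eq0C (e2 _ _)) sub0r.
  by rewrite (hdot_eq0C (o1 _ _ _)) ?oppr0 //; exact: e2.
move=> [d r] dr0.
have {}dr0 h : '[to_defect_space T1 (T2 h), d] + '[to_defect_space T2 h, r] = 0.
  exact: dr0 h.
(* As [|w|^2 = |d|^2 + |r|^2], it suffices to show [w = 0]. *)
pose w := W1 d + V1 (W2 r).
have nw : `|w| ^+ 2 = `|d| ^+ 2 + `|r| ^+ 2.
  by rewrite norm2D iW1 iV1 iW2 cross hdot_eq0C // !addr0.
have wP k : '[w, Pi k] = 0.
  rewrite hdotDl ext1 ?ext2 ?addr0 // => g.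
  by apply: o1 => k'; exact: e2.
pose l h := V1 (V2 (Pi h)) - Pi (T1 (T2 h)).
have lE h : l h = W1 (to_defect_space T1 (T2 h)) + V1 (W2 (to_defect_space T2 h)).
  by rewrite W1E W2E linearB /= addrC addrA subrK.
have lP n h k : '[iter n (V1 \o V2) (l h), Pi k] = 0.
  elim: n k => [|n IH] k /=.
    rewrite lE W1E W2E hdotDl e1 add0r; apply: o1 => k'; exact: e2.
  by apply: o1 => {}k; exact: o2.
(* For [n = 0] this is the orthogonality assumed of [(d, r)]. For later [n] the vector is
   [V1 (V2 x)] with [x] orthogonal to [Ran Pi]; tested on the vectors generating [w], cancelling
   isometries leaves only products with [Ran Pi], which vanish. *)
have wl n h : '[iter n (V1 \o V2) (l h), w] = 0.
  case: n => [|n] /=.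
    rewrite lE /w hdotDl !hdotDr cross (hdot_eq0C (cross _ _)) addr0 add0r.
    by rewrite isometric_hdot // isometric_hdot // isometric_hdot.
  set x := iter n _ _; have xP := lP n h; rewrite -/x in xP.
  apply: hdot_eq0C; rewrite hdotDl ext1 ?ext2 ?addr0 // => g; apply: hdot_eq0C.
    rewrite isometric_hdot // hdotBr isometric_hdot // xP o2 ?subrr //.
  rewrite hdotBr isometric_hdot // o2 // o1 ?subrr //; exact: o2.
have w0 : w = 0.
  (* With [V = V1 V2] and [T = T1 T2], the induction uses
     [V^(n+1) Pi h = V^n (l h) + V^n Pi (T h)]. *)
  apply: minP => n; elim: n => [|n IH] h; first exact/hdot_eq0C/wP.
  have -> : iter n.+1 (V1 \o V2) (Pi h) =
      iter n (V1 \o V2) (l h) + iter n (V1 \o V2) (Pi (T1 (T2 h))).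
    have itD x y : iter n (V1 \o V2) (x + y) =
        iter n (V1 \o V2) x + iter n (V1 \o V2) y.
      by elim: n {IH} => //= n ->; rewrite !linearD.
    by rewrite -itD subrK iterSr.
  by rewrite hdotDl wl IH addr0.
move: nw; rewrite w0 normr0 expr0n /= => /esym/eqP.
rewrite paddr_eq0 ?exprn_ge0 // !expf_eq0 /= !normr_eq0.
by case/andP => /eqP -> /eqP ->.
Qed.

End LiftTotal.

(** * Construction of the lift *)

Section Construction.
Variables (R : realType) (H : hilbertType R[i]).
Local Notation C := R[i].

Lemma unitary_inverse (D K : hilbertType C) (W : 'B(D, K)) : unitary W ->
  exists W' : 'B(K, D), [/\ isometric W', cancel W' W & cancel W W'].
Proof.
move=> [iW oW].
have [y|g Wg] := @choice K D (fun y x => W x = y).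
  by have : [set: K] y by []; rewrite -oW => -[x _ xy]; exists x.
have {}Wg : cancel g W by exact: Wg.
have gW : cancel W g.
  move=> x; apply/eqP; rewrite -subr_eq0 -normr_eq0 -iW linearB /= Wg subrr.
  by rewrite normr0.
have [W' W'E] : exists W' : 'B(K, D), W' =1 g.
  apply: bounded_operator_contr => [a x y|y]; last by rewrite -iW Wg.
  by rewrite -[RHS]gW linearP /= !Wg.
by exists W'; split=> [y|y|x]; rewrite W'E // -iW Wg.
Qed.

Section Shift.
Variables (F : hilbertType C) (T : 'B(H, H)) (s : hsum H (ell2 F) -> nat -> F).
Hypothesis s_linear : forall a (x y : hsum H (ell2 F)) k, s (a *: x + y) k = a *: s x k + s y k.

(* The partial sums of [s x] and [x.2] need only be compared up to one step. *)
Let energy (f : nat -> F) := series (fun k => rnorm (f k) ^+ 2).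
Let loss (h : H) := rnorm h ^+ 2 - rnorm (T h) ^+ 2.

Hypothesis s_le : forall (x : hsum H (ell2 F)) n, energy (s x) n <= loss x.1 + energy (val x.2) n.
Hypothesis s_ge : forall (x : hsum H (ell2 F)) n, loss x.1 + energy (val x.2) n <= energy (s x) n.+1.

(** In the limit the two bounds say that the sequence gains exactly [|h|^2 - |T h|^2], which the
    first component loses. *)
Lemma shift_isometry : exists V : 'B(hsum H (ell2 F), hsum H (ell2 F)),
  isometric V /\ forall x : hsum H (ell2 F), (V x).1 = T x.1 /\ val (V x).2 = s x.
Proof.
have sS x : s x \in @square_summable R F.
  rewrite inE; exists (loss x.1 + rnorm x.2 ^+ 2) => n.
  by apply: le_trans (s_le x n) _; rewrite lerD2l ell2_rnorm_ge.
pose f (x : hsum H (ell2 F)) : hsum H (ell2 F) := (T x.1, exist _ (s x) (sS x) : ell2 F).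
have f_norm (x : hsum H (ell2 F)) : `|f x| = `|x|.
  apply/eqP; rewrite -(eqrXn2 (n := 2)) // !rnormE -!rmorphXn (inj_eq (@complexI _)).
  rewrite !hsum_rnorm /= (_ : rnorm (exist _ _ _ : ell2 F) ^+ 2 = loss x.1 + rnorm x.2 ^+ 2).
    by rewrite /loss addrA addrCA subrr addr0.
  apply/eqP; rewrite eq_le; apply/andP; split.
    apply: ell2_rnorm_le => n; apply: le_trans (s_le x n) _.
    by rewrite lerD2l ell2_rnorm_ge.
  rewrite -lerBrDl; apply: ell2_rnorm_le => n; rewrite lerBrDl.
  by apply: le_trans (s_ge x n) _; exact: (@ell2_rnorm_ge _ _ (exist _ (s x) (sS x) : ell2 F)).
have [V VE] : exists V : 'B(hsum H (ell2 F), hsum H (ell2 F)), V =1 f.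
  apply: bounded_operator_contr => [a x y|x]; last by rewrite f_norm.
  rewrite /f; congr (_, _); first by rewrite linearP.
  by apply: val_inj; apply/funext => k; exact: s_linear.
by exists V; split=> x; rewrite VE.
Qed.

End Shift.

(** [p] and [q] are the energies of the delayed and of the undelayed component, [c] that of the
    inserted term. A delay moves one term of [p] past the cut-off, whence the slack of one step. *)
Lemma delayed_series (c : R) (p q r : nat -> R) n :
  0 <= c -> (forall k, 0 <= p k) -> (forall k, 0 <= q k) ->
  (forall k, r k = (if k is k'.+1 then p k' else c) + q k) ->
  series r n <= c + series (fun k => p k + q k) n <= series r n.+1.
Proof.
move=> c0 p0 q0 rE.
have rS m : series r m.+1 = c + series p m + series q m.+1.
  rewrite /series /= (eq_bigr _ (fun k _ => rE k)) big_split /= big_nat_recl //.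
have E m : series (fun k => p k + q k) m = series p m + series q m.
  by rewrite /series /= big_split.
have mono (f : nat -> R) m : (forall k, 0 <= f k) -> series f m <= series f m.+1.
  by move=> f0; rewrite /series /= big_nat_recr //= lerDl.
rewrite E rS addrA lerD2l mono // andbT.
(* For [n = 0] the left sum is empty and the bound is [0 <= c]. *)
case: n => [|n]; last by rewrite rS !lerD2r lerD2l mono.
by rewrite /series /= !big_geq // !addr0.
Qed.

Lemma has_sum_single n (c : C) : has_sum (fun k => if k == n then c else 0) c.
Proof.
have E (a : R) : series (fun k => if k == n then a else 0) @ \oo --> a.
  apply: cvg_near_cst; exists n.+1 => // m /= nm.
  by rewrite /series /= -big_mkcond /= big_nat1_eq nm.
split; [rewrite (_ : (fun k => _) = fun k => if k == n then complex.Re c else 0)|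
        rewrite (_ : (fun k => _) = fun k => if k == n then complex.Im c else 0)] => //.
  by apply/funext => k; case: eqP.
by apply/funext => k; case: eqP.
Qed.

Lemma ell2_valP (F : hilbertType C) a (x y : ell2 F) k :
  val (a *: x + y) k = a *: val x k + val y k.
Proof. by rewrite linearP. Qed.

Lemma ell2_hdot_single (F : hilbertType C) (x y : ell2 F) n (c : F) :
  (forall k, val x k = if k == n then c else 0) -> '[x, y] = '[c, val y n].
Proof.
move=> xE; rewrite -[LHS]/(ell2_dot x y); apply: ell2_dotE.
rewrite (_ : (fun k => _) = fun k => if k == n then '[c, val y n] else 0).
  exact: has_sum_single.
by apply/funext => k; rewrite xE; case: eqP => [->|_] //; rewrite hdot0l.
Qed.

Variables T1 T2 : 'B(H, H).
Hypotheses (T1_contr : contractive T1) (T2_contr : contractive T2).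
Hypothesis T12 : T1 \o T2 =1 T2 \o T1.
Hypotheses (total12 : total_map (defect_pair T1 T2))
           (total21 : total_map (defect_pair T2 T1)).

Local Notation D1 := (defect_space T1).
Local Notation D2 := (defect_space T2).
Local Notation F := (hsum D1 D2).
Local Notation d1 := (to_defect_space T1).
Local Notation d2 := (to_defect_space T2).

(** This is [defect_pair T2 T1] with its components exchanged, so as to lie in the same space as
    [defect_pair T1 T2]. *)
Definition swapped_pair (h : H) : F := (d1 h, d2 (T1 h)).

Lemma swapped_pair_total : total_map swapped_pair.
Proof.
move=> [a b] ab; have : (b, a) = 0 :> hsum D2 D1.
  apply: total21 => h; have : '[d1 h, a] + '[d2 (T1 h), b] = 0 by exact: ab.
  by rewrite addrC.
by case=> -> ->.
Qed.

(** By commutativity both pairs have the norm of [D_T h], where [T = T1 T2 = T2 T1]; both families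
    are total. *)
Lemma ando_unitary : exists W : 'B(F, F), unitary W /\
  forall h, W (defect_pair T1 T2 h) = swapped_pair h.
Proof.
apply: unitary_extension.
- exact: defect_pair_linear.
- by move=> a x y; rewrite /swapped_pair linearP !to_defect_space_linear.
- by move=> h; apply: (@defect_pair_contr _ _ (T1 \o T2)).
- exact: total12.
- move=> h; rewrite (@norm_defect_pair _ _ (T1 \o T2)) //.
  rewrite -(@norm_defect_pair _ _ (T1 \o T2) T2 T1) //.
  by apply/eqP; rewrite -(eqrXn2 (n := 2)) // !hsum_norm addrC.
exact: swapped_pair_total.
Qed.

Lemma rnorm2_to_defect_space (T : 'B(H, H)) h : contractive T ->
  rnorm (to_defect_space T h) ^+ 2 = rnorm h ^+ 2 - rnorm (T h) ^+ 2.
Proof.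
move=> cT; apply: complexI; rewrite rmorphB !rmorphXn /= -!rnormE.
exact: norm2_to_defect_space.
Qed.

Local Notation K := (hsum H (ell2 F)).

Lemma ando_shifts : exists V1 V2 : 'B(K, K),
  [/\ isometric V1, isometric V2,
      forall x : K, (V1 x).1 = T1 x.1, forall x : K, (V2 x).1 = T2 x.1 &
      forall (x : K) k, let y := if k is k'.+1 then val x.2 k' else swapped_pair x.1 in
        val (V1 (V2 x)).2 k = y /\ val (V2 (V1 x)).2 k = y].
Proof.
have [W [uW WE]] := ando_unitary; have iW := uW.1.
have [W' [iW' W'K WK]] := unitary_inverse uW.
pose s1 (x : K) k : F :=
  W (if k is k'.+1 then (val x.2 k').1 else d1 x.1, (val x.2 k).2).
pose s2 (x : K) k : F :=
  ((W' (val x.2 k)).1, if k is k'.+1 then (W' (val x.2 k')).2 else d2 x.1).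
have rW x : rnorm (W x) = rnorm x by rewrite /rnorm iW.
have rW' x : rnorm (W' x) = rnorm x by rewrite /rnorm iW'.
have linearP_W a u v : W (a *: u + v) = a *: W u + W v by exact: linearP.
have linearP_W' a u v : W' (a *: u + v) = a *: W' u + W' v by exact: linearP.
have sqr0 (V : normedModType C) (x : V) : 0 <= rnorm x ^+ 2 by exact: sqr_ge0.
have shift1 (x : K) n :
    series (fun k => rnorm (s1 x k) ^+ 2) n <=
    rnorm x.1 ^+ 2 - rnorm (T1 x.1) ^+ 2 + series (fun k => rnorm (val x.2 k) ^+ 2) n <=
    series (fun k => rnorm (s1 x k) ^+ 2) n.+1.
  rewrite -rnorm2_to_defect_space //.
  rewrite (_ : (fun k => rnorm (val x.2 k) ^+ 2) =
    fun k => rnorm (val x.2 k).1 ^+ 2 + rnorm (val x.2 k).2 ^+ 2).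
    apply: delayed_series => // k.
    by rewrite rW hsum_rnorm; case: k.
  by apply/funext => k; exact: hsum_rnorm.
have shift2 (x : K) n :
    series (fun k => rnorm (s2 x k) ^+ 2) n <=
    rnorm x.1 ^+ 2 - rnorm (T2 x.1) ^+ 2 + series (fun k => rnorm (val x.2 k) ^+ 2) n <=
    series (fun k => rnorm (s2 x k) ^+ 2) n.+1.
  rewrite -rnorm2_to_defect_space //.
  rewrite (_ : (fun k => rnorm (val x.2 k) ^+ 2) =
    fun k => rnorm (W' (val x.2 k)).2 ^+ 2 + rnorm (W' (val x.2 k)).1 ^+ 2).
    apply: delayed_series => // k.
    by rewrite hsum_rnorm addrC; case: k.
  by apply/funext => k; rewrite -(rW' (val x.2 k)) hsum_rnorm addrC.
have [|||V1 [iV1 V1E]] := @shift_isometry F T1 s1.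
- move=> a x y k; have vE j := ell2_valP a x.2 y.2 j.
  rewrite /s1 -[(a *: x + y).2]/(a *: x.2 + y.2) -[(a *: x + y).1]/(a *: x.1 + y.1).
  rewrite -linearP_W; case: k => [|k]; last by rewrite !vE.
  by rewrite vE to_defect_space_linear.
- by move=> x n; have /andP[] := shift1 x n.
- by move=> x n; have /andP[] := shift1 x n.
have [|||V2 [iV2 V2E]] := @shift_isometry F T2 s2.
- move=> a x y k; have vE j := ell2_valP a x.2 y.2 j.
  rewrite /s2 -[(a *: x + y).2]/(a *: x.2 + y.2) -[(a *: x + y).1]/(a *: x.1 + y.1).
  case: k => [|k]; last by rewrite !vE !linearP_W'.
  by rewrite vE linearP_W' to_defect_space_linear.
- by move=> x n; have /andP[] := shift2 x n.
- by move=> x n; have /andP[] := shift2 x n.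
exists V1, V2; split=> // [x|x|x k y].
- by have [] := V1E x.
- by have [] := V2E x.
have [e1 e2] := V1E (V2 x); have [e3 e4] := V2E x.
have [e5 e6] := V2E (V1 x); have [e7 e8] := V1E x.
(* At index 0, [V1 V2] gives [W] of the defect pair, which is the swapped pair, while [V2 V1] gives
   the swapped pair directly. At later indices [W] and [W'] cancel. *)
rewrite e2 e6 /s1 /s2 e3 e4 e7 e8 /s1 /s2 /y; split; case: k {y} => [|k] /=.
- by rewrite -WE.
- by rewrite -surjective_pairing W'K.
- by rewrite WK.
- by rewrite !WK /= -surjective_pairing.
Qed.

End Construction.

Section Construction.
Variables (R : realType) (H : hilbertType R[i]).
Local Notation C := R[i].
Variables T1 T2 : 'B(H, H).
Hypotheses (T1_contr : contractive T1) (T2_contr : contractive T2).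
Hypothesis T12 : T1 \o T2 =1 T2 \o T1.
Hypotheses (total12 : total_map (defect_pair T1 T2))
           (total21 : total_map (defect_pair T2 T1)).

Local Notation D1 := (defect_space T1).
Local Notation D2 := (defect_space T2).
Local Notation F := (hsum D1 D2).
Local Notation d1 := (to_defect_space T1).
Local Notation d2 := (to_defect_space T2).


Local Notation K := (hsum H (ell2 F)).
Lemma strongly_minimal_lift_exists : has_strongly_minimal_ando_lift T1 T2.
Proof.
have [V1 [V2 [iV1 iV2 V1T V2T VV]]] := ando_shifts T1_contr T2_contr T12 total12 total21.
have V12 (x : K) k : val (V1 (V2 x)).2 k =
    if k is k'.+1 then val x.2 k' else swapped_pair T1 T2 x.1 by have [] := VV x k.
have V21 (x : K) k : val (V2 (V1 x)).2 k =
    if k is k'.+1 then val x.2 k' else swapped_pair T1 T2 x.1 by have [] := VV x k.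
have [Pi PiE] : exists Pi : 'B(H, K), Pi =1 (fun h => (h, 0)).
  apply: bounded_operator_contr => [a x y|x].
    by rewrite -[RHS]/((a *: x + y, a *: 0 + 0) : K) scaler0 addr0.
  by rewrite -ler_sqr ?nnegrE // hsum_norm normr0 expr0n /= addr0.
have adj (T : 'B(H, H)) (V : 'B(K, K)) : contractive T -> isometric V ->
    (forall x, (V x).1 = T x.1) -> adjoint V \o Pi =1 Pi \o adjoint T.
  move=> cT iV VT h; apply: hdot_inj => z /=.
  rewrite -(adjointP (isometric_contractive iV)) !PiE.
  have e (u : K) k : '[u, (k, 0) : K] = '[u.1, k].
    by rewrite -[LHS]/('[u.1, k] + '[u.2, 0]) hdot0r addr0.
  by rewrite !e VT adjointP.
exists K, Pi, V1, V2; have lift : is_ando_lift T1 T2 Pi V1 V2.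
  split=> //.
  - move=> h; rewrite PiE; apply/eqP; rewrite -(eqrXn2 (n := 2)) // hsum_norm.
    by rewrite normr0 expr0n /= addr0.
  - move=> x /=; rewrite [LHS]surjective_pairing [RHS]surjective_pairing.
    congr (_, _); first by rewrite !(V1T, V2T); exact: T12.
    by apply: val_inj; apply/funext => k; rewrite V12 V21.
  - exact: adj.
  - exact: adj.
split=> //; apply/seteqP; split=> // x _ S [subS genS].
apply: (@closed_subspace_full _ _ (ClosedSubspace subS)) => y y0.
have {genS}y0 n h : '[iter n (V1 \o V2) (Pi h), y] = 0.
  apply: y0; apply: genS; exists n => //; exists h => //.
  by rewrite iter_comp_comm //; exact: ando_lift_comm lift.
have y1 : y.1 = 0.
  apply: hdotxx_eq0; have := y0 0%N y.1; rewrite /= PiE.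
  by rewrite -[X in X = 0]/('[y.1, y.1] + '[0, y.2]) hdot0l addr0.
(* [z h] is the sequence whose only nonzero term is [swapped_pair h] at index 0, and [(V1 V2)^n]
   moves it to index [n]. So the [n]-th term of [y.2] is orthogonal to all swapped pairs. *)
pose z h := V1 (V2 (Pi h)) - Pi (T1 (T2 h)).
have zy n h : '[iter n (V1 \o V2) (z h), y] = 0.
  have itB u v : iter n (V1 \o V2) (u - v) =
      iter n (V1 \o V2) u - iter n (V1 \o V2) v.
    by elim: n => //= n ->; rewrite !linearB.
  by rewrite itB hdotBl y0 subr0 -iterSr y0.
have zE n h : (iter n (V1 \o V2) (z h)).1 = 0 /\
    forall k, val (iter n (V1 \o V2) (z h)).2 k = if k == n then swapped_pair T1 T2 h else 0.
  have z1 : (z h).1 = 0 by rewrite /z /= V1T V2T !PiE /= subrr.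
  have z2 k : val (z h).2 k = if k == 0%N then swapped_pair T1 T2 h else 0.
    have -> : (z h).2 = (V1 (V2 (Pi h))).2.
      by rewrite /z [Pi (T1 _)]PiE -[LHS]/((V1 (V2 (Pi h))).2 - 0) subr0.
    by rewrite V12 PiE; case: k.
  elim: n => [|n [IH1 IH2]]; first by split.
  rewrite iterS [X in (X : K).1]/= [X in (X : K).2]/=.
  split=> [|k]; first by rewrite V1T V2T IH1 !linear0.
  rewrite V12; case: k => [|k]; last by rewrite IH2 eqSS.
  rewrite IH1 /swapped_pair linear0.
  by congr (_, _); apply: val_inj; rewrite /= linear0.
rewrite [y]surjective_pairing y1 (_ : y.2 = 0) //.
apply: val_inj; apply/funext => n /=; apply: (swapped_pair_total total21) => h.
have [e1 e2] := zE n h; rewrite -(ell2_hdot_single _ e2) -(zy n h).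
by rewrite -[RHS]/('[_, _] + '[_, _]) e1 hdot0l add0r.
Qed.

End Construction.

(** * Canonical special Andô tuples *)

Section Tuple.
Variables (R : realType) (H : hilbertType R[i]).
Local Notation C := R[i].

(** Taken as the closed subspace [0] of [H], it inherits its Hilbert structure. *)
Lemma trivial_hilbert_exists : exists Z : hilbertType C, forall x : Z, x = 0.
Proof.
have S0 : is_closed_subspace [set 0 : H].
  split; last exact/accessible_closed_set1/hausdorff_accessible/norm_hausdorff.
  split; first by rewrite inE.
  by move=> a x y; rewrite !inE /= => -> ->; rewrite scaler0 addr0.
exists (subspace_type (ClosedSubspace S0)) => x; apply: val_inj => /=.
by have := valP x; rewrite inE.
Qed.

Lemma trivial_unitary (Z Z' : hilbertType C) :
  (forall x : Z, x = 0) -> (forall x : Z', x = 0) -> unitary (\0 : 'B(Z, Z')).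
Proof.
move=> Z0 Z'0; split; first by move=> x; rewrite (Z0 x) linear0 !normr0.
by apply/seteqP; split=> // y _; exists 0; rewrite // linear0 [RHS]Z'0.
Qed.

Lemma unitary_comp (A B D : hilbertType C) (f : 'B(B, D)) (g : 'B(A, B)) :
  unitary f -> unitary g -> unitary (f \o g : 'B(A, D)).
Proof.
move=> [iF oF] [ig og]; split=> [x|]; first by rewrite /= iF ig.
apply/seteqP; split=> // x _; have : [set: D] x by [].
rewrite -oF => -[y _ <-]; have : [set: B] y by [].
by rewrite -og => -[z _ <-]; exists z.
Qed.

Section TripleSum.
Variables D1 D2 Z : hilbertType C.
Local Notation F := (hsum D1 D2).
Local Notation E := (hsum D1 (hsum D2 Z)).

Lemma norm2_triple (x : E) : `|x| ^+ 2 = `|x.1| ^+ 2 + `|x.2.1| ^+ 2 + `|x.2.2| ^+ 2.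
Proof. by rewrite hsum_norm hsum_norm addrA. Qed.

Lemma trivial_summand : (forall x : Z, x = 0) ->
  exists e : 'B(F, E), unitary e /\ forall x, e x = (x.1, (x.2, 0)).
Proof.
move=> Z0; have [e eE] : exists e : 'B(F, E), e =1 (fun x => (x.1, (x.2, 0))).
  apply: bounded_operator_contr => [a x y|x].
    by rewrite -[RHS]/((a *: x.1 + y.1, (a *: x.2 + y.2, a *: 0 + 0)) : E) scaler0 addr0.
  by rewrite -ler_sqr ?nnegrE // norm2_triple normr0 expr0n addr0 hsum_norm.
exists e; split=> //; split.
  move=> x; apply/eqP; rewrite -(eqrXn2 (n := 2)) // norm2_triple eE /=.
  by rewrite normr0 expr0n addr0 hsum_norm.
apply/seteqP; split=> // -[a [b c]] _; exists (a, b) => //.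
by rewrite eE (Z0 c).
Qed.

Lemma first_coordinate : exists P : 'B(E, E), forall a b c, P (a, (b, c)) = (a, (0, 0)).
Proof.
have [P PE] : exists P : 'B(E, E), P =1 (fun x => (x.1, (0, 0))).
  apply: bounded_operator_contr => [a x y|x].
    by rewrite -[RHS]/((a *: x.1 + y.1, (a *: 0 + 0, a *: 0 + 0)) : E) !scaler0 !addr0.
  rewrite -ler_sqr ?nnegrE // !norm2_triple /= !normr0 expr0n /= !addr0 -addrA lerDl.
  by rewrite addr_ge0 // exprn_ge0.
by exists P => a b c; rewrite PE.
Qed.

End TripleSum.

(** Supplies the map [Tau] of [ando_tuple_eq] as a bounded operator; it is isometric for any [tau]
    because [Z] is zero. *)
Lemma change_trivial_summand (D1 D2 Z Z' : hilbertType C) (tau : 'B(Z, Z')) :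
  (forall x : Z, x = 0) ->
  exists S : 'B(hsum D1 (hsum D2 Z), hsum D1 (hsum D2 Z')), isometric S /\
    forall x, S x = (x.1, (x.2.1, tau x.2.2)).
Proof.
move=> Z0; pose f (x : hsum D1 (hsum D2 Z)) : hsum D1 (hsum D2 Z') :=
  (x.1, (x.2.1, tau x.2.2)).
have nf x : `|f x| = `|x|.
  apply/eqP; rewrite -(eqrXn2 (n := 2)) // !norm2_triple /=.
  by rewrite (Z0 x.2.2) linear0 !normr0.
have [S SE] : exists S : 'B(hsum D1 (hsum D2 Z), hsum D1 (hsum D2 Z')), S =1 f.
  apply: bounded_operator_contr => [a x y|x]; last by rewrite nf.
  rewrite /f -[RHS]/((a *: x.1 + y.1, (a *: x.2.1 + y.2.1,
    a *: tau x.2.2 + tau y.2.2)) : hsum D1 (hsum D2 Z')).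
  by rewrite -[X in (_, (_, X)) = _]/(tau (a *: x.2.2 + y.2.2)) (linearP tau).
by exists S; split=> // x; rewrite SE nf.
Qed.

Variables T1 T2 : 'B(H, H).
Hypotheses (T1_contr : contractive T1) (T2_contr : contractive T2).
Hypothesis T12 : T1 \o T2 =1 T2 \o T1.
Hypotheses (total12 : total_map (defect_pair T1 T2))
           (total21 : total_map (defect_pair T2 T1)).

Local Notation D1 := (defect_space T1).
Local Notation D2 := (defect_space T2).
Local Notation F := (hsum D1 D2).
Local Notation d1 := (to_defect_space T1).
Local Notation d2 := (to_defect_space T2).
Local Notation d := (to_defect_space (T1 \o T2)).

Lemma strongly_minimal_tuple_exists : exists t : ando_tuple T1 T2,
  [/\ is_canonical_special t, strongly_minimal_tuple t &
      forall x : ando_F0 t, x = 0].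
Proof.
have [Z0 Z00] := trivial_hilbert_exists.
pose E := ando_space T1 T2 Z0.
have [emb [uemb embE]] := @trivial_summand D1 D2 Z0 Z00.
have [P PE] := first_coordinate D1 D2 Z0.
have [prj [iprj prjK embK]] := unitary_inverse uemb.
have uprj : unitary prj.
  by split=> //; apply/seteqP; split=> // x _; exists (emb x).
have [W [uW WE]] := ando_unitary T1_contr T2_contr T12 total12 total21.
have [_ [Z [iZ ZE oZ]]] :=
  (@regular_factorizationP _ _ (T1 \o T2) T1 T2 T1_contr T2_contr (fun=> erefl)).2 total12.
have [iL oL] := unitary_comp uemb (conj iZ oZ).
(* Through the identification [emb] of [D1 (+) D2] with [E], [Z] becomes [Lambda] and [W] becomes
   [U]. Regularity of [T1 T2] makes [Lambda] onto. *)
exists (AndoTuple (emb \o Z : 'B(_, _)) P (emb \o (W \o prj) : 'B(E, E))).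
split=> //; split=> //=.
- by move=> h; rewrite ZE embE.
- exact: unitary_comp uemb (unitary_comp uW uprj).
- by move=> h; rewrite -(embE (defect_pair T1 T2 h)) embK WE embE.
exists (\0 : 'B(Z0, Z0)); first by split=> // x y; rewrite (Z00 x) hdot0l [X in '[_, X]]Z00 hdot0r.
by move=> a b c; rewrite PE.
Qed.

Lemma defect_triple_total (t : ando_tuple T1 T2) :
  is_canonical_special t -> strongly_minimal_tuple t ->
  total_map (fun h : H => (d1 (T2 h), (d2 h, 0)) : ando_space T1 T2 (ando_F0 t)).
Proof.
move=> ct mt; have := onto_total (@to_defect_space_total _ _ (T1 \o T2)) (ando_Lambda_isometric ct) mt.
by congr total_map; apply/funext => h /=; rewrite (ando_LambdaE ct).
Qed.

(** [(0, (0, x))] is orthogonal to a total family whose last components vanish. *)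
Lemma strongly_minimal_F0 (t : ando_tuple T1 T2) :
  is_canonical_special t -> strongly_minimal_tuple t -> forall x : ando_F0 t, x = 0.
Proof.
move=> ct mt x; have : (0, (0, x)) = 0 :> ando_space T1 T2 (ando_F0 t).
  apply: (defect_triple_total ct mt) => h.
  rewrite -[LHS]/('[d1 (T2 h), 0] + ('[d2 h, 0] + '[0, x])).
  by rewrite !hdot0r hdot0l !addr0.
by case.
Qed.

(** [Lambda] and [U] are prescribed on total families; [P] is fixed by its form, its part on the
    zero summand being trivial. *)
Lemma strongly_minimal_tuple_unique (t t' : ando_tuple T1 T2) :
  is_canonical_special t -> strongly_minimal_tuple t ->
  is_canonical_special t' -> strongly_minimal_tuple t' -> ando_tuple_eq t t'.
Proof.
move=> ct mt ct' mt'.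
have F0 := strongly_minimal_F0 ct mt; have F0' := strongly_minimal_F0 ct' mt'.
pose tau : 'B(ando_F0 t, ando_F0 t') := \0.
have [S [iS SE]] := @change_trivial_summand D1 D2 _ _ tau F0.
exists tau; first exact: trivial_unitary.
split=> x.
- rewrite /= -SE; apply: (eq_on_total (A := S \o ando_Lambda t : 'B(_, _))
      (@to_defect_space_total _ _ (T1 \o T2))).
  + by move=> y; rewrite /= iS (ando_Lambda_isometric ct).
  + by move=> y; rewrite (ando_Lambda_isometric ct').
  + by move=> h; rewrite /= (ando_LambdaE ct) (ando_LambdaE ct') SE.
- have [P0 _ PE] := ando_PE ct; have [P0' _ PE'] := ando_PE ct'.
  by case: x => a [b c]; rewrite /= PE /= PE' linear0.
- rewrite /= -!SE; apply: (eq_on_total (A := S \o ando_U t : 'B(_, _))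
      (B := ando_U t' \o S : 'B(_, _)) (defect_triple_total ct mt)).
  + by move=> y; rewrite /= iS (ando_U_unitary ct).1.
  + by move=> y; rewrite /= (ando_U_unitary ct').1 iS.
  + by move=> h; rewrite /= (ando_UE ct) !SE /= (ando_UE ct').
Qed.

End Tuple.

Theorem theorem4p6p4 (R : realType) (H : hilbertType R[i]) (T1 T2 : 'B(H, H))
    (T1_contractive : contractive T1) (T2_contractive : contractive T2)
    (T1T2_comm : T1 \o T2 =1 T2 \o T1) :
  (has_strongly_minimal_ando_lift T1 T2 <->
     regular_factorization (T1 \o T2) T1 T2 /\
     regular_factorization (T1 \o T2) T2 T1) /\
  (has_strongly_minimal_ando_lift T1 T2 ->
     exists t : ando_tuple T1 T2,
       (is_canonical_special t /\ strongly_minimal_tuple t) /\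
       forall t' : ando_tuple T1 T2,
         is_canonical_special t' -> strongly_minimal_tuple t' ->
         ando_tuple_eq t t').
Proof.
have totals : has_strongly_minimal_ando_lift T1 T2 ->
    total_map (defect_pair T1 T2) /\ total_map (defect_pair T2 T1).
  move=> [K [Pi [V1 [V2 [lift minV]]]]].
  have ortho y := strongly_minimal_ortho (y := y) lift minV.
  split; first exact: lift_defect_pair_total lift ortho.
  (* Exchanging the isometries gives a lift of [(T2, T1)] with the same powers of the product, hence
     the second regularity. *)
  have lift' : is_ando_lift T2 T1 Pi V2 V1 by case: lift; split=> // x; exact: esym.
  apply: (lift_defect_pair_total _ _ lift') => // y y0; apply: ortho => n h.
  by rewrite (eq_iter (ando_lift_comm lift)); exact: y0.
have reg12 := @regular_factorizationP R H (T1 \o T2) T1 T2 T1_contractive T2_contractive (fun=> erefl).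
have reg21 := @regular_factorizationP R H (T1 \o T2) T2 T1 T2_contractive T1_contractive T1T2_comm.
split; first split.
- by move=> /totals[/reg12 ? /reg21 ?].
- by move=> [/reg12 t12 /reg21 t21]; exact: strongly_minimal_lift_exists.
move=> /totals[t12 t21].
have [t [ct mt _]] := strongly_minimal_tuple_exists T1_contractive T2_contractive T1T2_comm t12 t21.
by exists t; split=> // t' ct' mt'; exact: strongly_minimal_tuple_unique.
Qed.
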